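(* Let $b^\varepsilon:\mathbb R\times\mathbb R^d\to\mathbb R^d$, $\varepsilon\in[0,\varepsilon_0)$, and $\Sigma\in\mathbb R^{d\times d}$ be constant, $A:=\Sigma\Sigma^{\mathsf T}$. Assume that there are constants $0<\lambda_-\le\lambda_+<\infty$ and $L,B,c_0,c_1>0$, independent of $t$ and $\varepsilon$, with $$\lambda_-|\xi|^2\le\langle A\xi,\xi\rangle\le\lambda_+|\xi|^2\quad(\xi\in\mathbb R^d),$$ $$|b^\varepsilon(t,x)-b^\varepsilon(t,y)|\le L|x-y|,\qquad|b^\varepsilon(t,0)|\le B,\qquad\langle b^\varepsilon(t,x),x\rangle\le c_0-c_1|x|^2$$ for all $t\in\mathbb R$, $x,y\in\mathbb R^d$, $\varepsilon\in[0,\varepsilon_0)$. Assume also that there are a measurable $\dot b:\mathbb R\times\mathbb R^d\to\mathbb R^d$ and remainders $r^\varepsilon$ with $b^\varepsilon(t,x)=b^0(t,x)+\varepsilon\dot b(t,x)+r^\varepsilon(t,x)$ and, for every $R>0$, $$\sup_{t\in\mathbb R,\,|x|\le R}|\dot b(t,x)|<\infty,\qquad\sup_{t\in\mathbb R,\,|x|\le R}\frac{|r^\varepsilon(t,x)|}{|\varepsilon|}\xrightarrow[\varepsilon\to0]{}0.$$ Fix a time step $h>0$ and let $\boldsymbol\mu^\varepsilon=(\mu_k^\varepsilon)_{k\in\mathbb Z}$ be the equivariant family of probability densities, $\mu^\varepsilon_{k+1}=L_k^\varepsilon\mu_k^\varepsilon$, associated with the reflected Euler--Maruyama chain on $I^d$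 $$X_{k+1}^\varepsilon=\mathcal R\bigl(F_k^\varepsilon(X_k^\varepsilon)+\sqrt h\,\Sigma\xi_k\bigr),\qquad F_k^\varepsilon(x):=x+h\,b^\varepsilon(t_k,x),$$ where $(\xi_k)_{k\in\mathbb Z}$ are independent standard Gaussian vectors in $\mathbb R^d$. Then $$\boldsymbol\eta=\lim_{\varepsilon\to0}\frac{\boldsymbol\mu^\varepsilon-\boldsymbol\mu^0}{\varepsilon}$$ exists in $\ell^\infty(\mathbb Z;L^1(I^d,m))$. Let $L_k=L_k^0$, $\mu_k=\mu_k^0$, define $\dot L_k:L^1(I^d,m)\to L^1(I^d,m)$ by $$(\dot L_k\varphi)(y)=\int_{I^d}\varphi(x)\,D_1k_{I,h}\bigl(F_k^0(x),y\bigr)\bigl[h\,\dot b(t_k,x)\bigr]\,dm(x),$$ and set $g_k:=\dot L_k\mu_k$. Then $$\eta_k=g_{k-1}+\sum_{j=1}^\infty L_{k-1}L_{k-2}\cdots L_{k-j}\,g_{k-j-1},$$ and the series converges absolutely in $L^1(I^d,m)$, uniformly in $k$.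
   Context: $I=[a,b]$ is a closed bounded interval, $\ell=b-a>0$, $m$ is normalized Lebesgue measure on $I^d$. $t_k=t_0+kh$, $k\in\mathbb Z$. The folding map $\mathcal R:\mathbb R^d\to I^d$ acts componentwise by $\mathcal R_I(s)=a+\ell-\bigl|((s-a)\bmod 2\ell)-\ell\bigr|$. $q_h$ is the Gaussian density of $\sqrt h\,\Sigma\xi_k$ on $\mathbb R^d$, and for $z\in\mathbb R^d$ the reflected Gaussian kernel $k_{I,h}(z,\cdot)$ is the density with respect to $m$ of the pushforward $\mathcal R_*(q_h(\cdot-z)\,dx)$. The annealed transfer operator of the chain is $$(L_k^\varepsilon\varphi)(y)=\int_{I^d}\varphi(x)\,k_{I,h}\bigl(F_k^\varepsilon(x),y\bigr)\,dm(x),\qquad\varphi\in L^1(I^d,m).$$ $D_1$ denotes the Fréchet derivative with respect to the first variable, viewing $z\mapsto k_{I,h}(z,\cdot)$ as an $L^1(I^d,m)$-valued map; $D_1k_{I,h}(z,\cdot)[u]$ is the derivative at $z$ in direction $u$. For each $\varepsilon$ the equivariant family of probability densities exists and is unique. The chain is the reflected discretization of the SDE $dY_t^\varepsilon=b^\varepsilon(t,Y^\varepsilon_t)dt+\Sigma\,dW_t$. *)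

(* Defs.v *)
(* MathComp-Analysis; R^d is 'cV[R]_d over an arbitrary realType R.           *)
From HB Require Import structures.
From mathcomp Require Import all_boot all_order all_algebra.
From mathcomp Require Import all_classical all_reals all_analysis.

Set Implicit Arguments.
Unset Strict Implicit.
Unset Printing Implicit Defensive.

Import Order.TTheory GRing.Theory Num.Theory.
Import numFieldNormedType.Exports.

Local Open Scope classical_set_scope.
Local Open Scope ring_scope.

(* The library has neither a sigma-algebra on matrices nor a d-dimensional    *)
(* Lebesgue measure.  Column vectors get the sigma-algebra generated by the   *)
(* coordinates, which is the Borel one.                                       *)

Definition cV_display : measure_display. Proof. by constructor. Qed.

Section measurable_cV.
Context {R : realType} (n : nat).

Definition coord_cV : 'I_n -> 'cV[R]_n -> measurableTypeR R :=
  fun i x => x i ord0.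

Let cV_set0 : g_sigma_preimage coord_cV set0.
Proof. exact: sigma_algebra0. Qed.

Let cV_setC A : g_sigma_preimage coord_cV A ->
  g_sigma_preimage coord_cV (~` A).
Proof. exact: sigma_algebraC. Qed.

Let cV_bigcup (F : (set 'cV[R]_n)^nat) :
  (forall i, g_sigma_preimage coord_cV (F i)) ->
  g_sigma_preimage coord_cV (\bigcup_i (F i)).
Proof. exact: sigma_algebra_bigcup. Qed.

HB.instance Definition _ := @isMeasurable.Build cV_display 'cV[R]_n
  (g_sigma_preimage coord_cV) cV_set0 cV_setC cV_bigcup.

Lemma measurable_coord_cV (i : 'I_n) :
  measurable_fun [set: 'cV[R]_n] (coord_cV i).
Proof.
move=> _ Y mY; rewrite setTI; apply: sub_sigma_algebra => /=.
rewrite -bigcup_seq/=; exists i => /=; first by rewrite mem_index_enum.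
by exists Y => //; rewrite setTI.
Qed.

Lemma measurable_fun_cVP d (T : measurableType d) (f : T -> 'cV[R]_n) :
  (forall i, measurable_fun [set: T] (coord_cV i \o f)) ->
  measurable_fun [set: T] f.
Proof.
move=> mf; suff : g_sigma_preimage (fun i => coord_cV i \o f) `<=` measurable.
  rewrite g_sigma_preimage_comp => prefS _ A mA.
  by apply: prefS; exists A.
apply: smallest_sub; first exact: sigma_algebra_measurable.
by rewrite -bigcup_seq => A [i _ [B mB <-]]; exact: mf.
Qed.

End measurable_cV.

(* The library's instance is shadowed by the one for subprobabilities.        *)
Lemma product_measure_sigma_finite d1 d2 (T1 : measurableType d1)
    (T2 : measurableType d2) (R : realType)
    (m1 : {sigma_finite_measure set T1 -> \bar R})
    (m2 : {sigma_finite_measure set T2 -> \bar R}) :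
  sigma_finite setT (m1 \x m2)%E.
Proof.
have /sigma_finiteP[F [TF ndF Foo]] := sigma_finiteT m1.
have /sigma_finiteP[G [TG ndG Goo]] := sigma_finiteT m2.
exists (fun n => F n `*` G n).
  rewrite -setXTT TF TG predeqE => -[x y]; split.
    move=> [/= [n _ Fnx] [k _ Gky]]; exists (maxn n k) => //; split.
    - by move: x Fnx; exact/subsetPset/ndF/leq_maxl.
    - by move: y Gky; exact/subsetPset/ndG/leq_maxr.
  by move=> [n _ []/= ? ?]; split; exists n.
move=> k; have [? ?] := Foo k; have [? ?] := Goo k.
split; first exact: measurableX.
by rewrite product_measure1E// lte_mul_pinfty// ge0_fin_numE.
Qed.

Section lebesgue_measure_cV.
Context {R : realType}.

Definition cons_cV n (p : measurableTypeR R * 'cV[R]_n) : 'cV[R]_n.+1 :=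
  \col_i (if unlift ord0 i is Some j then p.2 j ord0 else p.1).

Definition uncons_cV n (x : 'cV[R]_n.+1) : measurableTypeR R * 'cV[R]_n :=
  (x ord0 ord0, \col_j x (lift ord0 j) ord0).

Lemma cons_cVK n : cancel (@cons_cV n) (@uncons_cV n).
Proof.
move=> [t x]; rewrite /uncons_cV/=; congr pair.
  by rewrite mxE unlift_none.
by apply/colP => j; rewrite !mxE liftK.
Qed.

Lemma measurable_cons_cV n : measurable_fun setT (@cons_cV n).
Proof.
apply: measurable_fun_cVP => i; rewrite /coord_cV/=.
case: (unliftP ord0 i) => [j ->|->].
  rewrite (_ : _ \o _ = coord_cV j \o snd); last first.
    by apply/funext => p /=; rewrite mxE liftK.
  by apply: measurableT_comp => //; exact: measurable_coord_cV.
rewrite (_ : _ \o _ = fst)//.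
by apply/funext => p /=; rewrite mxE unlift_none.
Qed.

Lemma measurable_uncons_cV n : measurable_fun setT (@uncons_cV n).
Proof.
apply: measurable_fun_pair; first exact: (@measurable_coord_cV R n.+1 ord0).
apply: measurable_fun_cVP => j.
rewrite (_ : _ \o _ = coord_cV (lift ord0 j)).
  exact: measurable_coord_cV.
by apply/funext => x; rewrite /coord_cV/= mxE.
Qed.

Section step.
Context n (mu : {sigma_finite_measure set 'cV[R]_n -> \bar R}).

Definition lebesgue_cons_cV : set 'cV[R]_n.+1 -> \bar R :=
  pushforward ((@lebesgue_measure R) \x mu)%E (@cons_cV n).

HB.instance Definition _ := Measure.copy lebesgue_cons_cV
  (measure_function_pushforward__canonical__measure_function_Measure
     ((@lebesgue_measure R) \x mu)%E (@measurable_cons_cV n)).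

Let lebesgue_cons_cV_sigma_finite : sigma_finite setT lebesgue_cons_cV.
Proof.
have [F FT Foo] := product_measure_sigma_finite (@lebesgue_measure R) mu.
exists (fun i => @uncons_cV n @^-1` F i) => [|i].
  by rewrite -preimage_bigcup -FT preimage_setT.
split.
  rewrite -[X in measurable X]setTI.
  by apply: measurable_uncons_cV => //; exact: (Foo i).1.
rewrite /lebesgue_cons_cV /pushforward (_ : _ @^-1` _ = F i); first exact: (Foo i).2.
by rewrite -comp_preimage; apply/seteqP; split => p /=; rewrite cons_cVK.
Qed.

HB.instance Definition _ := Measure_isSigmaFinite.Build _ _ _
  lebesgue_cons_cV lebesgue_cons_cV_sigma_finite.

End step.

Fixpoint lebesgue_cV (n : nat) : {sigma_finite_measure set 'cV[R]_n -> \bar R} :=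
  match n with
  | 0 => \d_(0 : 'cV[R]_0)
  | n'.+1 => lebesgue_cons_cV (lebesgue_cV n')
  end.

End lebesgue_measure_cV.

Section L1.
Context d {T : measurableType d} {R : realType}.
Variable m : {measure set T -> \bar R}.

Definition L1norm (f : T -> R) : \bar R := 'N[m]_1[EFin \o f].

(* The norm of l^oo(Z; L^1(m)), with value +oo on unbounded families. *)
Definition linfL1norm (u : int -> T -> R) : \bar R :=
  ereal_sup (range (fun k => L1norm (u k))).

(* f is a version of the density of nu with respect to m. *)
Definition is_density (nu : set T -> \bar R) (f : T -> R) : Prop :=
  [/\ measurable_fun setT f,
      {ae m, forall y, 0 <= f y} &
      forall B, measurable B -> nu B = (\int[m]_(y in B) (f y)%:E)%E].

Definition is_probability_density (f : T -> R) : Prop :=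
  [/\ measurable_fun setT f,
      {ae m, forall y, 0 <= f y} &
      (\int[m]_y (f y)%:E = 1)%E].

End L1.

Section euclidean.
Context {R : realType} (d : nat).
Implicit Types x y : 'cV[R]_d.

Definition dot x y : R := \sum_(i < d) x i ord0 * y i ord0.

(* The library norm on matrices is the sup norm. *)
Definition enorm x : R := Num.sqrt (dot x x).

(* Density of the centred Gaussian vector with covariance C. *)
Definition gaussian_density (C : 'M[R]_d) x : R :=
  expR (- dot (invmx C *m x) x / 2) / Num.sqrt ((2 * pi) ^+ d * \det C).

End euclidean.

Section reflection.
Context {R : realType}.

Definition rmod (s p : R) : R := s - p * (Num.floor (s / p))%:~R.

Definition folding (a b s : R) : R :=
  a + (b - a) - `|rmod (s - a) (2 * (b - a)) - (b - a)|.

Definition folding_cV (a b : R) d (x : 'cV[R]_d) : 'cV[R]_d :=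
  map_mx (folding a b) x.

Definition cube (a b : R) {d} : set 'cV[R]_d :=
  [set x | forall i, a <= x i ord0 <= b].

Lemma measurable_cube (a b : R) d :
  measurable (cube a b : set 'cV[R]_d).
Proof.
rewrite (_ : cube a b =
    \bigcap_(i in [set: 'I_d]) (coord_cV i @^-1` `[a, b]%classic)).
  apply: fin_bigcap_measurable => [|i _]; first exact: finite_finset.
  rewrite -[X in measurable X]setTI.
  exact: measurable_coord_cV.
apply/seteqP; split => x /= xab i; last by have := xab i I; rewrite /= in_itv.
by move=> _; rewrite /= in_itv; exact: xab.
Qed.

(* Normalized Lebesgue measure on I^d, as a measure on R^d carried by I^d, so *)
(* that L^1(I^d, m) is L^1 of this measure.  The absolute value is harmless   *)
(* for a < b; it makes the scaling factor visibly nonnegative.                *)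
Definition cube_measure (a b : R) d : {measure set 'cV[R]_d -> \bar R} :=
  mscale ((`|b - a| ^- d)%:nng)
    (mrestr (lebesgue_cV d) (@measurable_cube a b d)).

End reflection.

Section chain.
Context {R : realType} (d : nat).
Local Notation V := 'cV[R]_d.
Variables (a b h : R) (Sigma : 'M[R]_d).
Local Notation m := (cube_measure a b d).

Definition noise_density : V -> R :=
  gaussian_density (h *: (Sigma *m Sigma^T)).

(* The measure q_h(. - z) dx on R^d. *)
Definition noise_measure (z : V) : set V -> \bar R :=
  fun B => (\int[lebesgue_cV d]_(x in B) (noise_density (x - z))%:E)%E.

(* The kernel k_{I,h}(z, .) is only determined up to m-null sets for each z;  *)
(* joint measurability makes the transfer operators below independent of the  *)
(* choice of versions.                                                        *)
Definition is_reflected_kernel (kern : V -> V -> R) : Prop :=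
  measurable_fun setT (fun p : V * V => kern p.1 p.2) /\
  forall z, is_density m (pushforward (noise_measure z) (@folding_cV R a b d))
                         (kern z).

(* Dk z u y is a jointly measurable version of D_1 k(z, y)[u], the Frechet    *)
(* derivative of z |-> k(z, .) in L^1(m).                                     *)
Definition is_kernel_derivative (kern : V -> V -> R) (Dk : V -> V -> V -> R)
    : Prop :=
  measurable_fun setT (fun p : V * V * V => Dk p.1.1 p.1.2 p.2) /\
  forall z : V,
    [/\ forall u, Dk z u \in Lfun m 1,
        forall (c : R) (u v : V),
          {ae m, forall y, Dk z (c *: u + v) y = c * Dk z u y + Dk z v y},
        exists M : R, forall u, (L1norm m (Dk z u) <= (M * enorm u)%:E)%E &
        forall e : R, 0 < e -> \forall u \near (0 : V),
          (L1norm m (fun y => kern (z + u) y - kern z y - Dk z u y)%R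
            <= (e * enorm u)%:E)%E].

Definition euler_map (beta : R -> V -> V) (t : int -> R) (k : int) (x : V) : V :=
  x + h *: beta (t k) x.

Definition transfer (kern : V -> V -> R) (F : int -> V -> V) (k : int)
    (phi : V -> R) : V -> R :=
  fun y => (\int[m]_x (phi x * kern (F k x) y))%R.

Definition transfer_dot (Dk : V -> V -> V -> R) (F : int -> V -> V)
    (bdot : R -> V -> V) (t : int -> R) (k : int) (phi : V -> R) : V -> R :=
  fun y => (\int[m]_x (phi x * Dk (F k x) (h *: bdot (t k) x) y))%R.

Definition equivariant (L : int -> (V -> R) -> V -> R) (mu : int -> V -> R)
    : Prop :=
  (forall k, is_probability_density m (mu k)) /\
  forall k, {ae m, forall y, mu (k + 1) y = L k (mu k) y}.

End chain.

(* cocycle L k j f = L_{k-1} L_{k-2} ... L_{k-j} f *)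
Fixpoint cocycle {X : Type} (L : int -> X -> X) (k : int) (j : nat) (f : X) : X :=
  match j with
  | 0 => f
  | j'.+1 => L (k - 1) (cocycle L (k - 1) j' f)
  end.

(* Main.v *)
From HB Require Import structures.
Require Import Defs.
From mathcomp Require Import all_boot all_order all_algebra.
From mathcomp Require Import all_classical all_reals all_analysis.
From mathcomp Require Import measurable_realfun ring lra.

Set Implicit Arguments.
Unset Strict Implicit.
Unset Printing Implicit Defensive.

Import Order.TTheory GRing.Theory Num.Theory.
Import numFieldNormedType.Exports.

Local Open Scope classical_set_scope.
Local Open Scope ring_scope.

(** The transfer operators are treated as integral operators with kernels
    K e k x y = kern (F e k x) y on L1(m).  A point of the cube is moved by the
    Euler map into a ball that depends neither on time nor on e, and over that
    ball the reflected Gaussian kernel is bounded below by some delta > 0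
    (kern_lower_bound).  Subtracting delta from the kernel does not change its
    action on functions of mean zero, so that every operator contracts those by
    the factor theta = 1 - delta (doeblin_contraction, chain_contracting).

    Two facts about recursions u_(k+1) = L_k u_k + w_k on the two-sided time axis
    follow for such a contracting family: a bounded solution is at most
    sup |w| / (1 - theta) (driven_recursion_bound), and the series in the theorem
    converges geometrically to a solution with forcing term g
    (response_recursion).  The quotient (mu e k - mu 0 k) / e solves the recursion
    of the unperturbed operators with forcing term (L e k - L 0 k) / e applied to
    mu e k.  The bound shows first that the quotient is bounded, hence that mu e
    tends to mu 0, and then, applied to its difference with the series, that the
    latter is the limit as soon as the forcing term tends to g uniformly in k
    (response_approximation).

    What remains is that z |-> kern z is differentiable in L1(m) with a quadratic
    remainder whose constant does not depend on z.  On the whole space this is a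
    pointwise Taylor bound for the Gaussian density with an integrable, Gaussian
    constant (gaussian_density_taylor), made uniform in z by the translation
    invariance of Lebesgue measure.  Folding does not increase L1 norms of
    differences of densities (image_density_contraction), so dyadic difference
    quotients of kern form geometrically Cauchy sequences in L1(m); their limits
    are the partial derivatives (kern_derivative_uniform).  Working with
    quotients of the given kernel avoids folding the derivative of the Gaussian,
    and taking the limit pointwise makes the derivative jointly measurable.  Any
    other derivative agrees with this one almost everywhere
    (kernel_derivative_unique), so it yields the same series. *)

(** * The space L1 *)

Section L1_basics.
Context d {T : measurableType d} {R : realType}.
Variable m : {measure set T -> \bar R}.
Implicit Types f g : T -> R.
Local Notation L1 := (Lfun m 1%E).
Local Notation N1 := (L1norm m).

Lemma L1normE f : N1 f = (\int[m]_x `|f x|%:E)%E.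
Proof. by rewrite /L1norm Lnorm1; apply: eq_integral => x _ /=. Qed.

Lemma L1norm_ge0 f : (0 <= N1 f)%E.
Proof. exact: Lnorm_ge0. Qed.

Lemma Lfun1P f : f \in L1 <-> measurable_fun setT f /\ (N1 f < +oo)%E.
Proof.
split; first by case/andP; rewrite !inE.
by case=> mf nf; apply/andP; rewrite !inE.
Qed.

Lemma Lfun1_measurable f : f \in L1 -> measurable_fun setT f.
Proof. by case/Lfun1P. Qed.

Lemma measurable_normE f : measurable_fun setT f ->
  measurable_fun setT (fun x => `|f x|%:E).
Proof. by move=> mf; apply/measurable_EFinP; exact: measurableT_comp. Qed.

Lemma L1norm_le_integral f (g : T -> \bar R) : measurable_fun setT f ->
  measurable_fun setT g -> (forall x, (0 <= g x)%E) ->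
  {ae m, forall x, (`|f x|%:E <= g x)%E} -> (N1 f <= \int[m]_x g x)%E.
Proof.
move=> mf mg g0 fg; rewrite L1normE; apply: ae_ge0_le_integral => //.
- exact: measurable_normE.
- by apply: filterS fg.
Qed.

Lemma L1norm_le f g : measurable_fun setT f -> measurable_fun setT g ->
  {ae m, forall x, `|f x| <= `|g x|} -> (N1 f <= N1 g)%E.
Proof.
move=> mf mg fg; rewrite [leRHS]L1normE; apply: L1norm_le_integral => //.
exact: measurable_normE.
Qed.

Lemma L1norm_leD f g1 g2 : measurable_fun setT f ->
  measurable_fun setT g1 -> measurable_fun setT g2 ->
  {ae m, forall x, `|f x| <= `|g1 x| + `|g2 x|} -> (N1 f <= N1 g1 + N1 g2)%E.
Proof.
move=> mf mg1 mg2 fg; rewrite [N1 g1]L1normE [N1 g2]L1normE.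
rewrite -ge0_integralD//; try exact: measurable_normE.
apply: L1norm_le_integral => //.
  by apply: emeasurable_funD; exact: measurable_normE.
by move=> x; rewrite adde_ge0.
Qed.

Lemma L1norm_ae f g : measurable_fun setT f -> measurable_fun setT g ->
  {ae m, forall x, f x = g x} -> N1 f = N1 g.
Proof.
move=> mf mg fg; apply/eqP; rewrite eq_le.
by apply/andP; split; apply: L1norm_le => //; apply: filterS fg => x ->.
Qed.

Lemma L1norm_eq f g : f =1 g -> N1 f = N1 g.
Proof. by move=> fg; congr L1norm; exact/funext. Qed.

Lemma L1normD f g : measurable_fun setT f -> measurable_fun setT g ->
  (N1 (fun x => (f x + g x)%R) <= N1 f + N1 g)%E.
Proof.
move=> mf mg; apply: L1norm_leD => //; first exact: measurable_funD.
by apply: aeW => x; exact: ler_normD.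
Qed.

Lemma L1normB f g : measurable_fun setT f -> measurable_fun setT g ->
  (N1 (fun x => (f x - g x)%R) <= N1 f + N1 g)%E.
Proof.
move=> mf mg; apply: L1norm_leD => //; first exact: measurable_funB.
by apply: aeW => x; exact: ler_normB.
Qed.

Lemma L1norm_distC f g : N1 (fun x => f x - g x) = N1 (fun x => g x - f x).
Proof. by rewrite !L1normE; apply: eq_integral => x _; rewrite distrC. Qed.

Lemma L1normZ c f : measurable_fun setT f ->
  N1 (fun x => c * f x) = (`|c|%:E * N1 f)%E.
Proof.
move=> mf; rewrite !L1normE -ge0_integralZl//; last exact: measurable_normE.
by apply: eq_integral => x _; rewrite normrM EFinM.
Qed.

Lemma L1norm0 : N1 (fun=> 0) = 0%E.
Proof. by rewrite L1normE integral0_eq// => x _; rewrite normr0. Qed.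

Lemma L1norm_eq0 f : measurable_fun setT f -> (N1 f <= 0)%E ->
  {ae m, forall x, f x = 0}.
Proof.
move=> mf f0; have /(@ae_eq_integral_abs _ _ _ m _ measurableT) : 
    (\int[m]_x `|(EFin \o f) x| = 0)%E.
  by apply/eqP; rewrite eq_le; move: f0; rewrite L1normE /= => ->/=; exact: integral_ge0.
move=> /(_ _)[]; first exact/measurable_EFinP.
move=> A [mA A0 h]; exists A; split => // x /= nx; apply: h => /=.
by move=> /(_ I) [].
Qed.

Lemma L1norm_sum (I : Type) (s : seq I) (f : I -> T -> R) (c : I -> R) :
  (forall i, measurable_fun setT (f i)) ->
  (forall i, (N1 (f i) <= (c i)%:E)%E) ->
  (N1 (fun x => (\sum_(i <- s) f i x)%R) <= (\sum_(i <- s) c i)%:E)%E.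
Proof.
move=> mf fc; elim: s => [|i s ih].
  under eq_fun do rewrite big_nil.
  by rewrite big_nil L1norm0.
under eq_fun do rewrite big_cons.
rewrite big_cons EFinD; apply: le_trans (leeD (fc i) ih).
by apply: L1normD => //; apply: measurable_sum.
Qed.

Lemma Lfun1D f g : f \in L1 -> g \in L1 -> (fun x => f x + g x) \in L1.
Proof.
move=> /Lfun1P[mf nf] /Lfun1P[mg ng]; apply/Lfun1P; split.
  exact: measurable_funD.
by apply: le_lt_trans (L1normD mf mg) _; exact: lte_add_pinfty.
Qed.

Lemma Lfun1Z c f : f \in L1 -> (fun x => c * f x) \in L1.
Proof.
move=> /Lfun1P[mf nf]; apply/Lfun1P; split; first exact: measurable_funM.
by rewrite L1normZ// lte_mul_pinfty.
Qed.

Lemma Lfun1B f g : f \in L1 -> g \in L1 -> (fun x => f x - g x) \in L1.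
Proof.
move=> /Lfun1P[mf nf] /Lfun1P[mg ng]; apply/Lfun1P; split.
  exact: measurable_funB.
by apply: le_lt_trans (L1normB mf mg) _; exact: lte_add_pinfty.
Qed.

Lemma Lfun1_0 : (fun=> 0) \in L1.
Proof. by apply/Lfun1P; rewrite L1norm0. Qed.

Lemma Lfun1_sum (I : Type) (s : seq I) (f : I -> T -> R) :
  (forall i, f i \in L1) -> (fun x => \sum_(i <- s) f i x) \in L1.
Proof.
move=> fL; elim: s => [|i s ih].
  by under eq_fun do rewrite big_nil; exact: Lfun1_0.
by under eq_fun do rewrite big_cons; exact: Lfun1D.
Qed.

Lemma Lfun1_ae f g : f \in L1 -> measurable_fun setT g ->
  {ae m, forall x, g x = f x} -> g \in L1.
Proof.
move=> /Lfun1P[mf nf] mg gf; apply/Lfun1P; split => //.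
by rewrite (L1norm_ae mg mf gf).
Qed.

Lemma Lfun1_fin f : f \in L1 -> (N1 f)%E = (fine (N1 f))%:E.
Proof. by case/Lfun1P => _ nf; rewrite fineK// ge0_fin_numE// L1norm_ge0. Qed.

Lemma L1norm_boundW f (c : R) : measurable_fun setT f -> (N1 f <= c%:E)%E ->
  f \in L1.
Proof. by move=> mf fc; apply/Lfun1P; split => //; apply: le_lt_trans fc _; rewrite ltry. Qed.

End L1_basics.

(** * Geometrically Cauchy sequences in L1 *)

Section L1_limit.
Context d {T : measurableType d} {R : realType}.
Implicit Types f : nat -> T -> R.

(** The upper limit is measurable without any convergence hypothesis, in
    particular jointly in all variables on which f depends. *)
Definition pw_limit f (x : T) : R := fine (limn_esup (fun n => (f n x)%:E)).

Lemma measurable_pw_limit f : (forall n, measurable_fun setT (f n)) ->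
  measurable_fun setT (pw_limit f).
Proof.
move=> mf; apply: measurableT_comp => //.
by apply: measurable_fun_limn_esup => n; exact/measurable_EFinP.
Qed.

Lemma pw_limitE f x (l : R) : f n x @[n --> \oo] --> l -> pw_limit f x = l.
Proof.
move=> fl; rewrite /pw_limit is_cvg_limn_esupE; last first.
  by apply/cvg_ex; exists l%:E; apply: cvg_EFin => //; apply: nearW.
by rewrite (_ : limn _ = l%:E)//; apply: cvg_lim => //; apply: cvg_EFin => //; exact: nearW.
Qed.

Lemma sum_geometric_le (C q : R) (n k : nat) : 0 <= C -> 0 <= q < 1 ->
  \sum_(n <= i < k) C * q ^+ i <= C * q ^+ n / (1 - q).
Proof.
move=> C0 /andP[q0 q1]; have q1' : 0 < 1 - q by rewrite subr_gt0.
have [nk|kn] := leqP n k; last first.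
  rewrite big_geq ?(ltnW kn)//.
  by apply: divr_ge0; [apply: mulr_ge0 => //; exact: exprn_ge0|exact: ltW].
rewrite ler_pdivlMr//.
suff -> : (\sum_(n <= i < k) C * q ^+ i) * (1 - q) = C * q ^+ n - C * q ^+ k.
  by rewrite gerBl mulr_ge0 ?exprn_ge0.
elim: k nk => [|k ih]; first by rewrite leqn0 => /eqP ->; rewrite big_geq// mul0r subrr.
rewrite leq_eqVlt => /orP[/eqP <-|]; first by rewrite big_geq// mul0r subrr.
by rewrite ltnS => nk; rewrite big_nat_recr//= mulrDl ih// exprS; ring.
Qed.

Lemma nneseries_geometric_le (C q : R) (n : nat) (u : nat -> \bar R) :
  0 <= C -> 0 <= q < 1 -> (forall k, (0 <= u k <= (C * q ^+ k)%:E)%E) ->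
  (\sum_(n <= k <oo) u k <= (C * q ^+ n / (1 - q))%:E)%E.
Proof.
move=> C0 q01 u0; apply: lime_le.
  by apply: is_cvg_nneseries => k _ _; case/andP: (u0 k).
apply: nearW => N; apply: le_trans (_ : (\sum_(n <= k < N) C * q ^+ k)%:E <= _)%E.
  by rewrite -sumEFin; apply: lee_sum => k _; case/andP: (u0 k).
by rewrite lee_fin sum_geometric_le.
Qed.

Variable m : {measure set T -> \bar R}.

(** The increments have a summable total L1 norm, so their pointwise sum is
    almost everywhere absolutely convergent. *)
Lemma pw_limit_L1_geometric f (C q : R) : 0 <= C -> 0 <= q < 1 ->
  (forall n, measurable_fun setT (f n)) ->
  (forall n, L1norm m (fun x => f n.+1 x - f n x)%R <= (C * q ^+ n)%:E)%E ->
  forall n, (L1norm m (fun x => pw_limit f x - f n x)%R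
             <= (C * q ^+ n / (1 - q))%:E)%E.
Proof.
move=> C0 q01 mf df n.
pose v k x : \bar R := `|f k.+1 x - f k x|%:E.
have mv k : measurable_fun setT (v k).
  by apply: measurable_normE; exact: measurable_funB.
have v0 k x : (0 <= v k x)%E by rewrite lee_fin.
pose S j x := (\sum_(k <oo) v (k + j)%N x)%E.
have mS j : measurable_fun setT (S j).
  by apply: (@ge0_emeasurable_sum _ _ _ _ (fun k => v (k + j)%N) xpredT).
have S0 j x : (0 <= S j x)%E by apply: nneseries_ge0.
have iS j : (\int[m]_x S j x <= (C * q ^+ j / (1 - q))%:E)%E.
  rewrite /S integral_nneseries// -[C * _]mulr1 -(expr0 q).
  apply: nneseries_geometric_le => // [|k].
    by apply: mulr_ge0 => //; apply: exprn_ge0; case/andP: q01.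
  rewrite integral_ge0//= -L1normE; apply: le_trans (df _) _.
  by rewrite lee_fin addnC exprD mulrA.
apply: le_trans (iS n); apply: L1norm_le_integral => //.
  by apply: measurable_funB => //; exact: measurable_pw_limit.
have : m.-integrable setT (S 0%N).
  apply/integrableP; split => //.
  under eq_integral do rewrite gee0_abs//.
  by apply: le_lt_trans (iS 0%N) _; rewrite ltry.
move=> /integrable_ae => /(_ measurableT); apply: filterS => x /= /(_ I) Sfin.
have cvS : cvgn (series (fun k => `|f k.+1 x - f k x|)).
  move: Sfin; rewrite ge0_fin_numE// => Sfin.
  apply: nondecreasing_is_cvgn.
    by apply: nondecreasing_series => k _.
  exists (fine (S 0%N x)) => _ [k _ <-].
  rewrite -lee_fin fineK ?ge0_fin_numE// /series/= -sumEFin.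
  rewrite /S; under eq_eseriesr do rewrite addn0.
  by apply: nneseries_lim_ge => j _ _; exact: v0.
have cvf : cvgn (fun k => f k x).
  have := normed_cvg cvS; rewrite /series /=.
  under eq_fun do rewrite telescope_sumr//.
  move=> /cvg_ex[l hl]; apply/cvg_ex; exists (l + f 0%N x).
  rewrite (_ : (fun k => f k x) = (fun k => (f k x - f 0%N x) + f 0%N x)).
    by apply: cvgD => //; exact: cvg_cst.
  by apply/funext => k; rewrite subrK.
have [l fl] := (cvg_ex _).1 cvf.
rewrite (pw_limitE fl).
have : `|f k x - f n x|%:E @[k --> \oo] --> `|l - f n x|%:E.
  apply: cvg_EFin; first exact: nearW.
  by apply: cvg_norm; apply: cvgB => //; exact: cvg_cst.
move=> h; have <- := cvg_lim _ h => //.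
apply: lime_le; first by apply/cvg_ex; exists `|l - f n x|%:E.
exists n => // k /= nk.
rewrite -(telescope_sumr (fun k => f k x))//.
apply: le_trans (_ : (\sum_(n <= i < k) v i x <= _)%E); last first.
  rewrite -{1}[n]add0n big_addn.
  by apply: nneseries_lim_ge => j _ _; exact: v0.
by rewrite /v sumEFin lee_fin; exact: ler_norm_sum.
Qed.

End L1_limit.

(** * Integral operators on L1 *)

Section mean.
Context d {T : measurableType d} {R : realType}.
Variable m : {measure set T -> \bar R}.
Implicit Types f g : T -> R.

Lemma ae_eq_Rintegral f g : measurable_fun setT f -> measurable_fun setT g ->
  {ae m, forall x, f x = g x} -> \int[m]_x f x = \int[m]_x g x.
Proof.
move=> mf mg fg; rewrite /Rintegral; congr fine; apply: ae_eq_integral => //.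
- exact/measurable_EFinP.
- exact/measurable_EFinP.
- by apply: filterS fg => x -> _.
Qed.

Lemma Lfun1_meanD f g : f \in Lfun m 1%E -> g \in Lfun m 1%E ->
  \int[m]_x (f x + g x) = \int[m]_x f x + \int[m]_x g x.
Proof. by move=> /Lfun1_integrable fi /Lfun1_integrable gi; rewrite RintegralD. Qed.

Lemma Lfun1_meanB f g : f \in Lfun m 1%E -> g \in Lfun m 1%E ->
  \int[m]_x (f x - g x) = \int[m]_x f x - \int[m]_x g x.
Proof. by move=> /Lfun1_integrable fi /Lfun1_integrable gi; rewrite RintegralB. Qed.

Lemma Lfun1_meanZ c f : f \in Lfun m 1%E ->
  \int[m]_x (c * f x) = c * \int[m]_x f x.
Proof. by move=> /Lfun1_integrable fi; rewrite RintegralZl. Qed.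

Lemma le_mean_L1norm f : f \in Lfun m 1%E ->
  (`|\int[m]_x f x|%:E <= L1norm m f)%E.
Proof.
move=> /Lfun1_integrable fi; rewrite L1normE EFin_normr_Rintegral//.
by apply: le_abse_integral => //; exact: measurable_int fi.
Qed.

Lemma L1norm_mean f : f \in Lfun m 1%E -> {ae m, forall x, 0 <= f x} ->
  L1norm m f = (\int[m]_x f x)%:E.
Proof.
move=> fL f0; have /Lfun1_integrable fi := fL.
have mf := Lfun1_measurable fL.
rewrite /Rintegral fineK; last exact: integrable_fin_num.
rewrite L1normE; apply: ae_eq_integral => //.
- exact: measurable_normE.
- exact/measurable_EFinP.
- by apply: filterS f0 => x f0 _; rewrite ger0_norm.
Qed.

End mean.

Section integral_operator.
Context d {T : measurableType d} {R : realType}.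
Variable m : {sigma_finite_measure set T -> \bar R}.
Implicit Types (K : T -> T -> R) (phi psi : T -> R).
Local Notation L1 := (Lfun m 1%E).
Local Notation N1 := (L1norm m).

Definition intop K phi : T -> R := fun y => \int[m]_x (phi x * K x y).

(** Schur's test on L1: under this condition intop K is bounded with norm at
    most C. *)
Definition L1_kernel K (C : R) :=
  measurable_fun setT (fun p : T * T => K p.1 p.2) /\
  {ae m, forall x, (N1 (K x) <= C%:E)%E}.

Lemma L1_kernel_section K C x : L1_kernel K C -> measurable_fun setT (K x).
Proof.
move=> [mK _]; rewrite (_ : K x = (fun p => K p.1 p.2) \o pair x)//.
exact: measurableT_comp.
Qed.

Lemma L1_kernelB K1 K2 C1 C2 : L1_kernel K1 C1 -> L1_kernel K2 C2 ->
  L1_kernel (fun x y => K1 x y - K2 x y) (C1 + C2).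
Proof.
move=> k1 k2; split; first by apply: measurable_funB; [case: k1|case: k2].
case: (k1) (k2) => _ b1 [_ b2]; apply: filterS2 b1 b2 => x b1 b2.
rewrite EFinD; apply: le_trans (leeD b1 b2).
by apply: L1normB; [exact: L1_kernel_section k1|exact: L1_kernel_section k2].
Qed.

Section bounded.
Variables (K : T -> T -> R) (C : R).
Hypothesis kK : L1_kernel K C.

Let mprod phi : phi \in L1 ->
  measurable_fun setT (fun p : T * T => phi p.1 * K p.1 p.2).
Proof.
move=> /Lfun1_measurable mphi; apply: measurable_funM; last by case: kK.
exact: measurableT_comp.
Qed.

Let inner_le phi : phi \in L1 ->
  (\int[m]_x \int[m]_y `|(phi x * K x y)%:E| <= C%:E * N1 phi)%E.
Proof.
move=> phiL; have mphi := Lfun1_measurable phiL.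
have mF : measurable_fun setT
    (fun x => \int[m]_y `|(phi x * K x y)%:E|)%E.
  apply: (measurable_fun_fubini_tonelli_F
      (fun p : T * T => `|(phi p.1 * K p.1 p.2)%:E|%E)) => //.
  by apply: measurableT_comp => //; apply/measurable_EFinP; exact: mprod.
have [C0|C0] := leP 0 C; last first.
  (* A negative bound on norms leaves room only for a null space. *)
  have m0 : {ae m, forall x : T, False}.
    case: kK => _; apply: filterS => x /(le_trans (L1norm_ge0 _ _)).
    by rewrite lee_fin leNgt C0.
  rewrite (ae_eq_integral (cst 0%E)) ?integral0//; last first.
    by apply: filterS m0.
  rewrite [N1 phi](_ : _ = 0%E) ?mule0//.
  rewrite -(L1norm0 m); apply: L1norm_ae => //.
  by apply: filterS m0.
rewrite L1normE -ge0_integralZl//; last exact: measurable_normE.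
apply: ae_ge0_le_integral => //.
- by move=> x _; exact: integral_ge0.
- by move=> x _; rewrite mule_ge0.
- by apply: measurable_funeM; exact: measurable_normE.
case: (kK) => _; apply: filterS => x Kx _.
rewrite muleC; apply: le_trans (lee_wpmul2l _ Kx) => //.
have mKx := L1_kernel_section x kK.
rewrite L1normE -ge0_integralZl//; last exact: measurable_normE.
rewrite le_eqVlt; apply/orP; left; apply/eqP; apply: eq_integral => y _.
by rewrite EFinM abseM.
Qed.

Lemma intop_integrable phi : phi \in L1 ->
  (m \x m)%E.-integrable setT (fun p : T * T => (phi p.1 * K p.1 p.2)%:E).
Proof.
move=> phiL; apply/integrable12ltyP.
  by apply/measurable_EFinP; exact: mprod.
apply: le_lt_trans (inner_le phiL) _.
by rewrite (Lfun1_fin phiL) -EFinM ltry.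
Qed.

Lemma intop_ae_integrable phi : phi \in L1 ->
  {ae m, forall y, (fun x => phi x * K x y) \in L1}.
Proof.
move=> phiL; have := ae_integrable2 (intop_integrable phiL).
by apply: filterS => y iy; apply/Lfun1_integrable.
Qed.

Lemma measurable_intop phi : phi \in L1 -> measurable_fun setT (intop K phi).
Proof.
move=> phiL; have := measurable_fubini_G (intop_integrable phiL).
by move=> h; apply: measurableT_comp h.
Qed.

Lemma L1norm_intop phi : phi \in L1 -> (N1 (intop K phi) <= C%:E * N1 phi)%E.
Proof.
move=> phiL; apply: le_trans (inner_le phiL).
have mphi := Lfun1_measurable phiL.
have mabs : measurable_fun setT (fun p : T * T => `|(phi p.1 * K p.1 p.2)%:E|%E).
  by apply: measurableT_comp => //; apply/measurable_EFinP; exact: mprod.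
rewrite (fubini_tonelli (fun p : T * T => `|(phi p.1 * K p.1 p.2)%:E|%E))//.
apply: L1norm_le_integral => //.
- exact: measurable_intop.
- exact: (measurable_fun_fubini_tonelli_G
    (fun p : T * T => `|(phi p.1 * K p.1 p.2)%:E|%E)).
- by move=> y; exact: integral_ge0.
apply: filterS (intop_ae_integrable phiL) => y /le_mean_L1norm.
by rewrite L1normE.
Qed.

Lemma Lfun1_intop phi : phi \in L1 -> intop K phi \in L1.
Proof.
move=> phiL; apply: (@L1norm_boundW _ _ _ _ _ (C * fine (N1 phi))).
  exact: measurable_intop.
by rewrite EFinM -Lfun1_fin// L1norm_intop.
Qed.

Lemma mean_intop c phi : phi \in L1 ->
  {ae m, forall x, \int[m]_y K x y = c} ->
  \int[m]_y intop K phi y = c * \int[m]_x phi x.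
Proof.
move=> phiL Kc; have mphi := Lfun1_measurable phiL.
have iphi := intop_integrable phiL.
rewrite -Lfun1_meanZ//.
transitivity (fine (\int[m]_y \int[m]_x (phi x * K x y)%:E)%E).
  rewrite /Rintegral; congr fine; apply: ae_eq_integral => //.
  - by apply/measurable_EFinP; exact: measurable_intop.
  - exact: (measurable_fubini_G iphi).
  - apply: filterS (intop_ae_integrable phiL) => y /Lfun1_integrable iy _ /=.
    by rewrite /intop /Rintegral fineK//; exact: integrable_fin_num.
rewrite -(Fubini iphi) /Rintegral; congr fine; apply: ae_eq_integral => //.
- exact: (measurable_fubini_F iphi).
- by apply/measurable_EFinP; apply: measurable_funM.
have [_ Kb] := kK; apply: filterS2 Kb Kc => x Kx <- _ /=.
have KxL : K x \in L1 by apply: L1norm_boundW Kx; exact: L1_kernel_section kK.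
have /Lfun1_integrable iKx := KxL.
rewrite mulrC -Lfun1_meanZ// /Rintegral fineK//.
by apply: integrable_fin_num => //; apply/Lfun1_integrable; exact: Lfun1Z.
Qed.

Lemma intopP c phi psi : phi \in L1 -> psi \in L1 ->
  {ae m, forall y, intop K (fun x => c * phi x + psi x) y =
                   c * intop K phi y + intop K psi y}.
Proof.
move=> phiL psiL.
apply: filterS2 (intop_ae_integrable phiL) (intop_ae_integrable psiL) => y i1 i2.
rewrite /intop -Lfun1_meanZ// -Lfun1_meanD//; last exact: Lfun1Z.
by apply: eq_Rintegral => x _; rewrite mulrDl mulrA.
Qed.

(** Integration forgets null sets, so the images coincide at every point. *)
Lemma intop_ae phi psi : measurable_fun setT phi -> measurable_fun setT psi ->
  {ae m, forall x, phi x = psi x} -> intop K phi = intop K psi.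
Proof.
move=> mphi mpsi e; apply/funext => y.
have mKy : measurable_fun setT (K ^~ y).
  rewrite (_ : K ^~ y = (fun p => K p.1 p.2) \o pair^~ y)//.
  by apply: measurableT_comp; [case: kK|exact: measurable_pair2].
apply: ae_eq_Rintegral; [exact: measurable_funM|exact: measurable_funM|].
by apply: filterS e => x ->.
Qed.

End bounded.

Lemma intop_kernelB K1 K2 C1 C2 phi : L1_kernel K1 C1 -> L1_kernel K2 C2 ->
  phi \in L1 ->
  {ae m, forall y, intop (fun x y => K1 x y - K2 x y) phi y =
                   intop K1 phi y - intop K2 phi y}.
Proof.
move=> k1 k2 phiL.
apply: filterS2 (intop_ae_integrable k1 phiL) (intop_ae_integrable k2 phiL).
move=> y i1 i2; rewrite /intop -Lfun1_meanB//.
by apply: eq_Rintegral => x _; rewrite mulrBr.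
Qed.

Lemma intop_kernelZ c K C phi : L1_kernel K C -> phi \in L1 ->
  {ae m, forall y, intop (fun x y => c * K x y) phi y = c * intop K phi y}.
Proof.
move=> k phiL; apply: filterS (intop_ae_integrable k phiL) => y i1.
rewrite /intop -Lfun1_meanZ//.
by apply: eq_Rintegral => x _; rewrite mulrCA.
Qed.

Lemma eq_intop_kernel K1 K2 C1 C2 phi : L1_kernel K1 C1 -> L1_kernel K2 C2 ->
  {ae m, forall x, {ae m, forall y, K1 x y = K2 x y}} -> phi \in L1 ->
  {ae m, forall y, intop K1 phi y = intop K2 phi y}.
Proof.
move=> k1 k2 e phiL.
have k12 : L1_kernel (fun x y => K1 x y - K2 x y) 0.
  split; first by case: (L1_kernelB k1 k2).
  apply: filterS e => x e; rewrite -[leRHS](L1norm0 m); apply: L1norm_le => //.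
    by apply: measurable_funB; [exact: L1_kernel_section k1|exact: L1_kernel_section k2].
  by apply: filterS e => y ->; rewrite subrr.
have := L1norm_intop k12 phiL; rewrite mul0e => /L1norm_eq0.
move=> /(_ (measurable_intop k12 phiL)) h.
apply: filterS2 h (intop_kernelB k1 k2 phiL) => y -> /esym/eqP.
by rewrite subr_eq0 => /eqP.
Qed.

(** On functions of mean zero a constant may be subtracted from the kernel;
    when the kernel stays above that constant this only lowers its mass. *)
Lemma doeblin_contraction K (mass delta : R) phi :
  (m setT < +oo)%E -> 
  measurable_fun setT (fun p : T * T => K p.1 p.2) ->
  {ae m, forall x, K x \in L1 /\ \int[m]_y K x y = mass} ->
  {ae m, forall x, {ae m, forall y, delta <= K x y}} ->
  0 <= delta ->
  phi \in L1 -> \int[m]_x phi x = 0 ->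
  (N1 (intop K phi) <= (mass - delta * fine (m setT))%:E * N1 phi)%E.
Proof.
move=> mT mK Kmass Klow d0 phiL phi0.
have mTfin : m setT \is a fin_num by rewrite ge0_fin_numE.
have cstL c : (fun=> c) \in L1.
  apply/Lfun1P; split => //; rewrite L1normE integral_cst//.
  by rewrite lte_mul_pinfty// lee_fin.
have kK : L1_kernel K mass.
  split => //; apply: filterS2 Kmass Klow => x [KL <-] low.
  rewrite (L1norm_mean KL)//; apply: filterS low => y; exact: le_trans.
have kc : L1_kernel (fun _ _ => delta) (delta * fine (m setT)).
  split=> //; apply: aeW => x; rewrite L1normE integral_cst//.
  by rewrite ger0_norm// EFinM fineK.
have kKc : L1_kernel (fun x y => K x y - delta) (mass - delta * fine (m setT)).
  split; first by apply: measurable_funB.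
  apply: filterS2 Kmass Klow => x [KL <-] low.
  rewrite L1norm_mean; last 2 first.
  - by apply: Lfun1B.
  - by apply: filterS low => y; rewrite subr_ge0.
  by rewrite Lfun1_meanB// Rintegral_cst.
rewrite (@L1norm_ae _ _ _ _ _ (intop (fun x y => K x y - delta) phi)).
- exact: L1norm_intop.
- exact (measurable_intop kK phiL).
- exact (measurable_intop kKc phiL).
apply: filterS (intop_kernelB kK kc phiL) => y ->.
rewrite [X in _ - X](_ : _ = 0) ?subr0// /intop.
by under eq_Rintegral do rewrite mulrC; rewrite Lfun1_meanZ// phi0 mulr0.
Qed.

End integral_operator.

(** * Driven linear recursions for contracting families *)

Section recursion.
Context d {T : measurableType d} {R : realType}.
Variable m : {measure set T -> \bar R}.
Implicit Types f g : T -> R.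
Local Notation L1 := (Lfun m 1%E).
Local Notation N1 := (L1norm m).

Definition L1_mean0 f := f \in L1 /\ \int[m]_x f x = 0.

Lemma L1_mean0D f g : L1_mean0 f -> L1_mean0 g -> L1_mean0 (fun x => f x + g x).
Proof.
by move=> [fL f0] [gL g0]; split; [exact: Lfun1D|rewrite Lfun1_meanD// f0 g0 addr0].
Qed.

Lemma L1_mean0B f g : L1_mean0 f -> L1_mean0 g -> L1_mean0 (fun x => f x - g x).
Proof.
by move=> [fL f0] [gL g0]; split; [exact: Lfun1B|rewrite Lfun1_meanB// f0 g0 subr0].
Qed.

Lemma L1_mean0Z c f : L1_mean0 f -> L1_mean0 (fun x => c * f x).
Proof.
by move=> [fL f0]; split; [exact: Lfun1Z|rewrite Lfun1_meanZ// f0 mulr0].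
Qed.

Lemma L1_mean0_0 : L1_mean0 (fun=> 0).
Proof. by split; [exact: Lfun1_0|rewrite /Rintegral integral0]. Qed.

Lemma L1_mean0_sum n (f : nat -> T -> R) : (forall i, L1_mean0 (f i)) ->
  L1_mean0 (fun x => \sum_(i < n) f i x).
Proof.
move=> f0; elim: n => [|n ih].
  by under eq_fun do rewrite big_ord0; exact: L1_mean0_0.
by under eq_fun do rewrite big_ord_recr/=; exact: L1_mean0D.
Qed.

Lemma L1_mean0_ae f g : L1_mean0 f -> measurable_fun setT g ->
  {ae m, forall x, g x = f x} -> L1_mean0 g.
Proof.
move=> [fL f0] mg gf; split; first exact: Lfun1_ae gf.
by rewrite -f0; apply: ae_eq_Rintegral => //; exact: Lfun1_measurable fL.
Qed.

(** Markov operators conserve the integral, so at best they contract the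
    functions of mean zero. *)
Definition contracting_family (L : int -> (T -> R) -> T -> R) (theta : R) :=
  [/\ forall k f, L1_mean0 f -> L1_mean0 (L k f),
      forall k f, L1_mean0 f -> (N1 (L k f) <= theta%:E * N1 f)%E,
      forall k c f g, f \in L1 -> g \in L1 ->
        {ae m, forall y, L k (fun x => c * f x + g x) y = c * L k f y + L k g y} &
      forall k f g, measurable_fun setT f -> measurable_fun setT g ->
        {ae m, forall x, f x = g x} -> L k f = L k g].

Lemma le_geometric_limit (x b q c : R) : 0 <= q < 1 ->
  (forall n, x <= b * q ^+ n + c) -> x <= c.
Proof.
move=> /andP[q0 q1] h.
have cvg : (b * q ^+ n + c) @[n --> \oo] --> b * 0 + c.
  apply: cvgD; last exact: cvg_cst.
  by apply: cvgM; [exact: cvg_cst|apply: cvg_expr; rewrite ger0_norm].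
rewrite -[c]add0r -(mulr0 b) -(cvg_lim _ cvg)//.
by apply: limr_ge; [exact: cvgP cvg|exact: nearW].
Qed.

Lemma le_geometric_limit_L1norm f (b q c : R) : 0 <= q < 1 -> f \in L1 ->
  (forall n, N1 f <= (b * q ^+ n + c)%:E)%E -> (N1 f <= c%:E)%E.
Proof.
move=> q01 fL h; rewrite (Lfun1_fin fL) lee_fin.
by apply: (@le_geometric_limit _ b q) => // n; rewrite -lee_fin -Lfun1_fin.
Qed.

Section family.
Variables (L : int -> (T -> R) -> T -> R) (theta : R).
Hypothesis theta01 : 0 <= theta < 1.
Hypothesis cL : contracting_family L theta.

Let theta0 : 0 <= theta. Proof. by case/andP: theta01. Qed.
Let theta1 : 0 < 1 - theta. Proof. by rewrite subr_gt0; case/andP: theta01. Qed.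

Lemma contracting_familyB k f g : f \in L1 -> g \in L1 ->
  {ae m, forall y, L k (fun x => f x - g x) y = L k f y - L k g y}.
Proof.
move=> fL gL; case: cL => _ _ lin _; apply: filterS (lin k (- 1) g f gL fL) => y.
under [in X in X -> _]eq_fun do rewrite mulN1r addrC.
by move=> ->; rewrite mulN1r addrC.
Qed.

(** Running the recursion backwards n steps shows that u is within b theta^n of
    a sum of forcing terms; boundedness of u on the whole two-sided time axis
    then removes the influence of the remote past. *)
Lemma driven_recursion_bound (u w : int -> T -> R) (b c : R) :
  (forall k, L1_mean0 (u k)) -> (forall k, (N1 (u k) <= b%:E)%E) ->
  (forall k, measurable_fun setT (w k)) -> (forall k, (N1 (w k) <= c%:E)%E) ->
  (forall k, {ae m, forall y, u (k + 1) y = L k (u k) y + w k y}) ->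
  forall k, (N1 (u k) <= (c / (1 - theta))%:E)%E.
Proof.
move=> u0 ub mw wc rec k; case: cL => L0 Lb _ _.
apply: (@le_geometric_limit_L1norm _ b theta) => //; first by case: (u0 k).
move=> n; elim: n k => [|n ih] k.
  rewrite expr0 mulr1; apply: le_trans (ub k) _; rewrite lee_fin lerDl.
  rewrite divr_ge0 ?(ltW theta1)//.
  by have := le_trans (L1norm_ge0 m (w k)) (wc k); rewrite lee_fin.
rewrite -(subrK 1 k); set k' := k - 1.
have [uL _] := u0 (k' + 1); have [LuL _] := L0 k' _ (u0 k').
apply: (@le_trans _ _ (N1 (L k' (u k')) + N1 (w k'))%E).
  apply: L1norm_leD => //; [exact: Lfun1_measurable uL|exact: Lfun1_measurable LuL|].
  by apply: filterS (rec k') => y ->; exact: ler_normD.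
apply: (@le_trans _ _ ((theta * (b * theta ^+ n + c / (1 - theta)))%:E + c%:E)%E).
  apply: leeD (wc k'); apply: le_trans (Lb _ _ (u0 _)) _.
  by rewrite EFinM lee_wpmul2l.
rewrite -EFinD lee_fin exprS le_eqVlt; apply/orP; left; apply/eqP.
by field; rewrite gt_eqF.
Qed.

Lemma cocycle_mean0 k j f : L1_mean0 f -> L1_mean0 (cocycle L k j f).
Proof. by case: cL => L0 _ _ _ f0; elim: j k => [//|j ih] k /=; exact: L0. Qed.

Lemma cocycle_bound k j f (c : R) : L1_mean0 f -> (N1 f <= c%:E)%E ->
  (N1 (cocycle L k j f) <= (c * theta ^+ j)%:E)%E.
Proof.
move=> f0 fc; elim: j k => [|j ih] k; first by rewrite expr0 mulr1.
case: cL => _ Lb _ _ /=; apply: le_trans (Lb _ _ _) _; first exact: cocycle_mean0.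
by rewrite exprS mulrCA EFinM lee_wpmul2l.
Qed.

Lemma cocycle_ae k j f g : measurable_fun setT f -> measurable_fun setT g ->
  {ae m, forall x, f x = g x} ->
  {ae m, forall x, cocycle L k j f x = cocycle L k j g x}.
Proof.
move=> mf mg fg; case: cL => _ _ _ Lae.
have [->//|j0] := posnP j.
suff -> : cocycle L k j f = cocycle L k j g by apply: aeW.
case: j j0 => [//|j _]; elim: j k => [|j ih] k /=; first exact: Lae.
by congr L; exact: ih.
Qed.

Lemma family_sum k n (f : nat -> T -> R) : (forall i, L1_mean0 (f i)) ->
  {ae m, forall y, L k (fun x => \sum_(i < n) f i x) y = \sum_(i < n) L k (f i) y}.
Proof.
case: cL => L0 Lb lin _ f0; elim: n => [|n ih].
  have -> : (fun x => \sum_(i < 0) f i x) = (fun=> 0).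
    by apply/funext => x; rewrite big_ord0.
  have [h _] := L0 k _ L1_mean0_0.
  apply: filterS (L1norm_eq0 (Lfun1_measurable h) _) => [y ->|].
    by rewrite big_ord0.
  by apply: le_trans (Lb _ _ L1_mean0_0) _; rewrite L1norm0 mule0.
have [sL _] := L1_mean0_sum n f0; have [fL _] := f0 n.
apply: filterS2 ih (lin k 1 _ _ sL fL) => y ihy.
rewrite big_ord_recr/= mul1r ihy => <-; congr (L k _ y).
by apply/funext => x; rewrite big_ord_recr/= mul1r.
Qed.

Section series_solution.
Variables (g : int -> T -> R) (c : R).
Hypothesis g0 : forall k, L1_mean0 (g k).
Hypothesis gc : forall k, (N1 (g k) <= c%:E)%E.

Definition response_term k j := cocycle L k j (g (k - j%:Z - 1)).

Definition response k : T -> R :=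
  pw_limit (fun n x => \sum_(j < n) response_term k j x).

Let c0 : 0 <= c.
Proof. by have := le_trans (L1norm_ge0 m (g 0)) (gc 0); rewrite lee_fin. Qed.

Lemma response_term_mean0 k j : L1_mean0 (response_term k j).
Proof. exact: cocycle_mean0. Qed.

Lemma response_term_bound k j :
  (N1 (response_term k j) <= (c * theta ^+ j)%:E)%E.
Proof. exact: cocycle_bound. Qed.

Lemma response_term0 k : response_term (k + 1) 0 = g k.
Proof. by rewrite /response_term/= subr0 addrK. Qed.

Lemma response_termS k j : response_term (k + 1) j.+1 = L k (response_term k j).
Proof.
rewrite /response_term /= addrK; congr (L _ (cocycle _ _ _ (g _))).
by rewrite intS; ring.
Qed.

Lemma measurable_response k : measurable_fun setT (response k).
Proof.
apply: measurable_pw_limit => n.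
by have [/Lfun1_measurable] := L1_mean0_sum n (response_term_mean0 k).
Qed.

Lemma response_partial_sum k n :
  (N1 (fun x => response k x - \sum_(j < n) response_term k j x)%R
   <= (c * theta ^+ n / (1 - theta))%:E)%E.
Proof.
apply: pw_limit_L1_geometric => // [{}n|{}n].
  by have [/Lfun1_measurable] := L1_mean0_sum n (response_term_mean0 k).
apply: le_trans (response_term_bound k n).
rewrite le_eqVlt; apply/orP; left; apply/eqP; apply: L1norm_eq => x.
by rewrite big_ord_recr/= addrAC subrr add0r.
Qed.

Lemma response_bound k : (N1 (response k) <= (c / (1 - theta))%:E)%E.
Proof.
have := response_partial_sum k 0; rewrite expr0 mulr1; apply: le_trans.
rewrite le_eqVlt; apply/orP; left; apply/eqP; apply: L1norm_eq => x.
by rewrite big_ord0 subr0.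
Qed.

Lemma response_mean0 k : L1_mean0 (response k).
Proof.
have rL : response k \in L1.
  by apply: L1norm_boundW (response_bound k); exact: measurable_response.
split=> //; apply/eqP; rewrite -normr_le0.
apply: (@le_geometric_limit _ (c / (1 - theta)) theta) => // n.
have [sL s0] := L1_mean0_sum n (response_term_mean0 k).
rewrite addr0 -lee_fin -[\int[m]_x _]subr0 -{1}s0 -Lfun1_meanB//.
apply: le_trans (le_mean_L1norm _) _; first exact: Lfun1B.
by rewrite -mulrAC; exact: response_partial_sum.
Qed.

(** The series is the solution of the recursion: shifting its first n terms by
    one time step gives the first n+1 terms at the next time. *)
Lemma response_recursion k :
  {ae m, forall y, response (k + 1) y = L k (response k) y + g k y}.
Proof.
case: (cL) => L0 Lb lin _.
have [rL _] := response_mean0 (k + 1); have [LrL _] := L0 k _ (response_mean0 k).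
have [gL _] := g0 k.
pose D := fun x => response (k + 1) x - (L k (response k) x + g k x).
have DL : D \in L1 by apply: Lfun1B => //; exact: Lfun1D.
suff : (N1 D <= 0%:E)%E.
  move=> /L1norm_eq0 -/(_ (Lfun1_measurable DL)); apply: filterS => y /eqP.
  by rewrite subr_eq0 => /eqP.
apply: (@le_geometric_limit_L1norm _ (2 * theta * c / (1 - theta)) theta) => // n.
pose S j n := fun x => \sum_(i < n) response_term j i x.
have S0 j i : L1_mean0 (S j i) by apply: L1_mean0_sum; exact: response_term_mean0.
have rS0 : L1_mean0 (fun x => S k n x - response k x).
  by apply: L1_mean0B => //; exact: response_mean0.
apply: (@le_trans _ _ (N1 (fun x => response (k + 1) x - S (k + 1) n.+1 x)%R +
    N1 (L k (fun x => S k n x - response k x)%R))%E).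
  apply: L1norm_leD.
  - exact: Lfun1_measurable DL.
  - apply: measurable_funB; first exact: measurable_response.
    by have [/Lfun1_measurable] := S0 (k + 1) n.+1.
  - by have [/Lfun1_measurable] := L0 k _ rS0.
  have [SL _] := S0 k n; have [r'L _] := response_mean0 k.
  apply: filterS2 (contracting_familyB k SL r'L)
    (family_sum k n (response_term_mean0 k)) => y -> /= Sy.
  suff -> : D y = (response (k + 1) y - S (k + 1) n.+1 y) +
      (L k (S k n) y - L k (response k) y) by exact: ler_normD.
  rewrite /D /S Sy big_ord_recl/= response_term0.
  under eq_bigr do rewrite response_termS.
  ring.
rewrite addr0 (_ : _ * _ = c * theta ^+ n.+1 / (1 - theta) +
   theta * (c * theta ^+ n / (1 - theta))); last by rewrite exprS; ring.
rewrite EFinD; apply: leeD; first exact: response_partial_sum.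
apply: le_trans (Lb _ _ rS0) _; rewrite EFinM lee_wpmul2l//.
by rewrite L1norm_distC; exact: response_partial_sum.
Qed.

End series_solution.
End family.
End recursion.

(** * Euclidean geometry of column vectors *)

Section euclidean_norm.
Context {R : realType} {n : nat}.
Implicit Types (x y z : 'cV[R]_n) (c : R) (M : 'M[R]_n).

Lemma dotC x y : dot x y = dot y x.
Proof. by apply: eq_bigr => i _; rewrite mulrC. Qed.

Lemma dotDl x y z : dot (x + y) z = dot x z + dot y z.
Proof. by rewrite -big_split; apply: eq_bigr => i _; rewrite mxE mulrDl. Qed.

Lemma dotDr x y z : dot z (x + y) = dot z x + dot z y.
Proof. by rewrite dotC dotDl !(dotC z). Qed.

Lemma dotZl c x y : dot (c *: x) y = c * dot x y.
Proof. by rewrite mulr_sumr; apply: eq_bigr => i _; rewrite mxE mulrA. Qed.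

Lemma dotZr c x y : dot y (c *: x) = c * dot y x.
Proof. by rewrite dotC dotZl dotC. Qed.

Lemma dotNl x y : dot (- x) y = - dot x y.
Proof. by rewrite -scaleN1r dotZl mulN1r. Qed.

Lemma dotNr x y : dot y (- x) = - dot y x.
Proof. by rewrite dotC dotNl dotC. Qed.

Lemma dot_ge0 x : 0 <= dot x x.
Proof. by apply: sumr_ge0 => i _; rewrite -expr2 sqr_ge0. Qed.

Lemma enorm_ge0 x : 0 <= enorm x.
Proof. exact: sqrtr_ge0. Qed.

Lemma sqr_enorm x : enorm x ^+ 2 = dot x x.
Proof. by rewrite sqr_sqrtr// dot_ge0. Qed.

Lemma enorm0 : enorm (0 : 'cV[R]_n) = 0.
Proof. by rewrite /enorm /dot big1 ?sqrtr0// => i _; rewrite mxE mul0r. Qed.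

Lemma enormZ c x : enorm (c *: x) = `|c| * enorm x.
Proof.
by rewrite /enorm dotZl dotZr mulrA -expr2 sqrtrM ?sqr_ge0// sqrtr_sqr.
Qed.

Lemma enormN x : enorm (- x) = enorm x.
Proof. by rewrite -scaleN1r enormZ normrN1 mul1r. Qed.

Lemma ler_coord_enorm x i : `|x i ord0| <= enorm x.
Proof.
rewrite -(ler_pXn2r (n:=2)) ?nnegrE ?enorm_ge0// sqr_enorm real_normK ?num_real//.
rewrite /dot (bigD1 i)//= -expr2 lerDl.
by apply: sumr_ge0 => j _; rewrite -expr2 sqr_ge0.
Qed.

Lemma enorm_eq0 x : enorm x = 0 -> x = 0.
Proof.
move=> x0; apply/colP => i; apply/eqP; rewrite mxE -normr_le0 -x0.
exact: ler_coord_enorm.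
Qed.

Lemma cauchy_schwarz x y : dot x y <= enorm x * enorm y.
Proof.
have [x0|x0] := eqVneq (enorm x) 0.
  rewrite x0 mul0r (enorm_eq0 x0) /dot big1// => i _.
  by rewrite mxE mul0r.
have xp : 0 < enorm x by rewrite lt_def x0 enorm_ge0.
have [y0|y0] := eqVneq (enorm y) 0.
  rewrite y0 mulr0 (enorm_eq0 y0) /dot big1// => i _.
  by rewrite mxE mulr0.
have yp : 0 < enorm y by rewrite lt_def y0 enorm_ge0.
have := dot_ge0 (enorm y *: x - enorm x *: y).
rewrite !(dotDl, dotDr, dotNl, dotNr, dotZl, dotZr) -!sqr_enorm (dotC y x) => h.
have xy : 0 < enorm x * enorm y by rewrite mulr_gt0.
by rewrite -(ler_pM2l xy); nra.
Qed.

Lemma ler_enormD x y : enorm (x + y) <= enorm x + enorm y.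
Proof.
rewrite -(ler_pXn2r (n:=2)) ?nnegrE ?addr_ge0 ?enorm_ge0//.
rewrite sqr_enorm !(dotDl, dotDr) -!sqr_enorm (dotC y x).
by have := cauchy_schwarz x y; nra.
Qed.

Lemma enorm_le_sum x : enorm x <= \sum_(i < n) `|x i ord0|.
Proof.
have s0 : 0 <= \sum_(i < n) `|x i ord0| by apply: sumr_ge0.
rewrite -(ler_pXn2r (n:=2)) ?nnegrE ?enorm_ge0// sqr_enorm /dot expr2 mulr_suml.
apply: ler_sum => i _; rewrite -expr2 -real_normK ?num_real// expr2 ler_wpM2l//.
by rewrite (bigD1 i)//= lerDl sumr_ge0.
Qed.

Definition entry_sum M : R := \sum_i \sum_j `|M i j|.

Lemma entry_sum_ge0 M : 0 <= entry_sum M.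
Proof. by apply: sumr_ge0 => i _; apply: sumr_ge0. Qed.

Lemma enorm_mulmx M x : enorm (M *m x) <= entry_sum M * enorm x.
Proof.
apply: le_trans (enorm_le_sum _) _; rewrite /entry_sum mulr_suml.
apply: ler_sum => i _; rewrite mxE mulr_suml; apply: le_trans (ler_norm_sum _ _ _) _.
by apply: ler_sum => j _; rewrite normrM ler_wpM2l// ler_coord_enorm.
Qed.

Lemma normr_dot x y : `|dot x y| <= enorm x * enorm y.
Proof.
rewrite ler_norml cauchy_schwarz andbT lerNl -dotNl -[enorm x]enormN.
exact: cauchy_schwarz.
Qed.

Lemma normr_dot_mulmx M x y : `|dot (M *m x) y| <= entry_sum M * (enorm x * enorm y).
Proof.
apply: le_trans (normr_dot _ _) _; rewrite mulrA ler_wpM2r ?enorm_ge0//.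
exact: enorm_mulmx.
Qed.

Lemma bounded_below_unitmx M (c : R) : 0 < c ->
  (forall x, c * enorm x ^+ 2 <= dot (M *m x) x) -> M \in unitmx.
Proof.
move=> c0 Mc; rewrite -unitmx_tr -row_free_unit; apply: inj_row_free => v vM.
apply: trmx_inj; rewrite trmx0; apply: enorm_eq0.
have : M *m v^T = 0 by apply: trmx_inj; rewrite trmx_mul trmxK vM trmx0.
move=> Mv; have := Mc v^T; rewrite Mv {1}/dot big1 => [|i _]; last first.
  by rewrite mxE mul0r.
rewrite pmulr_rle0// => v0; apply/eqP; rewrite -sqrf_eq0 eq_le v0.
exact: sqr_ge0.
Qed.

End euclidean_norm.

(** * Lebesgue integration on column vectors *)

Section measurable_vectors.
Context {R : realType} {n : nat}.
Context {d : measure_display} {T : measurableType d}.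
Implicit Types f g : T -> 'cV[R]_n.

Lemma measurable_coord f i : measurable_fun setT f ->
  measurable_fun setT (fun t => f t i ord0 : R).
Proof.
move=> mf; exact: (measurableT_comp (measurable_coord_cV (R:=R) i) mf).
Qed.

Lemma measurable_cVP f : (forall i, measurable_fun setT (fun t => f t i ord0 : R)) ->
  measurable_fun setT f.
Proof. by move=> mf; apply: measurable_fun_cVP => i; exact: mf. Qed.

Lemma measurable_cVD f g : measurable_fun setT f -> measurable_fun setT g ->
  measurable_fun setT (fun t => f t + g t).
Proof.
move=> mf mg; apply: measurable_cVP => i.
by under eq_fun do rewrite mxE; apply: measurable_funD; exact: measurable_coord.
Qed.

Lemma measurable_cVZ (c : T -> R) f : measurable_fun setT c ->
  measurable_fun setT f -> measurable_fun setT (fun t => c t *: f t).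
Proof.
move=> mc mf; apply: measurable_cVP => i.
by under eq_fun do rewrite mxE; apply: measurable_funM => //; exact: measurable_coord.
Qed.

Lemma measurable_cVB f g : measurable_fun setT f -> measurable_fun setT g ->
  measurable_fun setT (fun t => f t - g t).
Proof.
move=> mf mg; apply: measurable_cVP => i.
under eq_fun do rewrite !mxE.
by apply: measurable_funB; exact: measurable_coord.
Qed.

Lemma measurable_dot_mulmx (M : 'M[R]_n) f g : measurable_fun setT f ->
  measurable_fun setT g -> measurable_fun setT (fun t => dot (M *m f t) (g t)).
Proof.
move=> mf mg; apply: measurable_sum => i; apply: measurable_funM; last first.
  exact: measurable_coord.
under eq_fun do rewrite mxE; apply: measurable_sum => j.
by apply: measurable_funM => //; exact: measurable_coord.
Qed.

End measurable_vectors.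

Section lebesgue_cV_integral.
Context {R : realType}.
Local Notation leb := (@lebesgue_measure R).

Lemma lebesgue_integral_shift (f : measurableTypeR R -> \bar R) (t : R) :
  measurable_fun setT f -> (forall x, (0 <= f x)%E) ->
  (\int[leb]_x f (x + t)%R = \int[leb]_x f x)%E.
Proof.
move=> mf f0.
pose s : measurableTypeR R -> measurableTypeR R := fun x => x + t.
have ms : measurable_fun setT s by apply: measurable_funD.
pose nu := measure_function_pushforward__canonical__measure_function_Measure leb ms.
have leb_s A : measurable A -> leb A = nu A.
  apply: lebesgue_measure_unique => _ [[u v]] _ <-.
  rewrite /nu/= /pushforward (_ : s @^-1` _ = `]u - t, v - t]%classic); last first.
    by apply/seteqP; split => x /=; rewrite !in_itv/= /s ltrBlDr lerBrDr.
  rewrite !lebesgue_measure_itv/= !lte_fin ltrD2r.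
  by case: ifP => // _; rewrite -!EFinB; congr EFin; ring.
transitivity (\int[nu]_x f x)%E.
  by rewrite (ge0_integral_pushforward ms)// preimage_setT.
by apply: eq_measure_integral => A mA _; exact/esym/leb_s.
Qed.

Lemma integral_lebesgue_cVS n (f : 'cV[R]_n.+1 -> \bar R) :
  measurable_fun setT f -> (forall x, (0 <= f x)%E) ->
  (\int[lebesgue_cV n.+1]_x f x =
   \int[leb]_t \int[lebesgue_cV n]_x f (cons_cV (t, x)))%E.
Proof.
move=> mf f0; have mc := @measurable_cons_cV R n.
transitivity (\int[(leb \x lebesgue_cV n)%E]_p f (cons_cV p))%E.
  exact: (@ge0_integral_pushforward _ _ _ _ _ _ mc _ setT).
by rewrite fubini_tonelli1//; exact: measurableT_comp.
Qed.

(** The iterated construction inherits translation invariance coordinate by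
    coordinate. *)
Lemma lebesgue_cV_shift n (f : 'cV[R]_n -> \bar R) (z : 'cV[R]_n) :
  measurable_fun setT f -> (forall x, (0 <= f x)%E) ->
  (\int[lebesgue_cV n]_x f (x + z)%R = \int[lebesgue_cV n]_x f x)%E.
Proof.
elim: n f z => [|n ih] f z mf f0.
  by apply: eq_integral => x _; congr f; apply/colP => -[].
have mfz : measurable_fun setT (fun x : 'cV[R]_n.+1 => f (x + z)).
  by apply: (measurableT_comp mf); exact: measurable_cVD.
rewrite (integral_lebesgue_cVS mfz (fun x => f0 _)) (integral_lebesgue_cVS mf f0).
have mcons : measurable_fun setT (f \o @cons_cV R n).
  by apply: measurableT_comp => //; exact: measurable_cons_cV.
pose g t := (\int[lebesgue_cV n]_x f (cons_cV (t, x)))%E.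
rewrite -[RHS](@lebesgue_integral_shift g (z ord0 ord0)); last 2 first.
- by have := measurable_fun_fubini_tonelli_F (m2 := lebesgue_cV n) (f \o @cons_cV R n) mcons (fun p => f0 _).
- by move=> t; exact: integral_ge0.
apply: eq_integral => t _; rewrite /g.
rewrite -[RHS](ih _ (\col_j z (lift ord0 j) ord0)); last 2 first.
- exact: (measurableT_comp mcons (measurable_pair1 _)).
- by move=> x.
apply: eq_integral => x _; congr f; apply/colP => i; rewrite !mxE.
by case: unliftP => [j ->|->]; rewrite ?mxE.
Qed.

Lemma lebesgue_cV_prod n (f : R -> R) : measurable_fun setT f -> (forall t, 0 <= f t) ->
  (\int[lebesgue_cV n]_x (\prod_(i < n) f (x i ord0))%:E =
   (\int[leb]_t (f t)%:E) ^+ n)%E.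
Proof.
move=> mf f0; elim: n => [|n ih].
  rewrite expe0; under eq_integral do rewrite big_ord0.
  by rewrite integral_cst//= diracT mule1.
have mprod k : measurable_fun setT (fun x : 'cV[R]_k => \prod_(i < k) f (x i ord0)).
  apply: measurable_prod => i _; apply: (measurableT_comp mf).
  exact: measurable_coord.
rewrite integral_lebesgue_cVS; last 2 first.
- by apply/measurable_EFinP; exact: mprod.
- by move=> x; rewrite lee_fin; apply: prodr_ge0.
transitivity (\int[leb]_t ((f t)%:E * (\int[leb]_t (f t)%:E) ^+ n))%E.
  apply: eq_integral => t _; rewrite -ih.
  rewrite -(ge0_integralZl _ measurableT ((measurable_EFinP _ _).2 (mprod n))); last 2 first.
  - by move=> x _; rewrite lee_fin; apply: prodr_ge0.
  - by rewrite lee_fin.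
  apply: eq_integral => x _; rewrite big_ord_recl mxE unlift_none -EFinM.
  by congr (_ * _)%:E; apply: eq_bigr => i _; rewrite mxE liftK.
rewrite ge0_integralZr//; last 3 first.
- exact/measurable_EFinP.
- by move=> t _; rewrite lee_fin.
- by apply: expe_ge0; apply: integral_ge0 => t _; rewrite lee_fin.
by rewrite expeS.
Qed.

Lemma integral_gauss_lty (a : R) : 0 < a ->
  (\int[leb]_t (expR (- (a * t ^+ 2)))%:E < +oo)%E.
Proof.
move=> a0; pose s : R := Num.sqrt ((2 * a)^-1).
have s0 : s != 0 by rewrite gt_eqF// sqrtr_gt0 invr_gt0 mulr_gt0.
have s2 : s ^+ 2 *+ 2 = a^-1.
  rewrite sqr_sqrtr ?invr_ge0 ?mulr_ge0 ?ltW// -mulr_natr invfM mulrC mulrA.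
  by rewrite divff ?mul1r.
have pk := normal_peak_gt0 s0.
have : ((normal_peak s)%:E * (\int[leb]_t (expR (- (a * t ^+ 2)))%:E) = 1)%E.
  rewrite -(@integral_normal_pdf R 0 s) -ge0_integralZl//; last 2 first.
  - apply/measurable_EFinP; apply: measurableT_comp => //.
    by apply: measurableT_comp => //; apply: measurable_funM => //; exact: measurable_funX.
  - by rewrite lee_fin ltW.
  apply: eq_integral => t _; rewrite normal_pdfE// /normal_fun subr0 s2 invrK.
  by rewrite -EFinM mulNr [_ * a]mulrC.
move=> h; rewrite ltNge leye_eq; apply/negP => /eqP e; move: h; rewrite e.
by rewrite gt0_muley// lte_fin.
Qed.

End lebesgue_cV_integral.

(** * Dyadic difference quotients *)

Section difference_quotients.
Context {R : realType} {n : nat}.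
Implicit Types (F l : 'cV[R]_n -> R) (e u : 'cV[R]_n).

(** Halving the step at each stage makes successive quotients geometrically
    close, as pw_limit_L1_geometric requires. *)
Definition dyadic_quotient F k e : R := 2 ^+ k * (F (2 ^- k *: e) - F 0).

Definition basis_cV (i : 'I_n) : 'cV[R]_n := delta_mx i ord0.

Lemma enorm_basis i : enorm (basis_cV i) = 1.
Proof.
rewrite /enorm /dot (bigD1 i)//= big1 => [|j ji]; last first.
  by rewrite !mxE (negbTE ji) mul0r.
by rewrite !mxE !eqxx mulr1 addr0 sqrtr1.
Qed.

Lemma decompose_cV u : u = \sum_i u i ord0 *: basis_cV i.
Proof. by rewrite {1}[u]matrix_sum_delta; apply: eq_bigr => i _; rewrite big_ord1. Qed.

Section pointwise.
Variables (F l : 'cV[R]_n -> R) (G : R).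
Hypothesis G0 : 0 <= G.
Hypothesis l_lin : forall c u v, l (c *: u + v) = c * l u + l v.
Hypothesis F_taylor : forall u, enorm u <= 1 -> `|F u - F 0 - l u| <= enorm u ^+ 2 * G.

Let l0 : l 0 = 0.
Proof. by have := l_lin (- 1) 0 0; rewrite scaler0 addr0 mulN1r addNr. Qed.

Let lZ c u : l (c *: u) = c * l u.
Proof. by rewrite -[c *: u]addr0 l_lin l0 addr0. Qed.

Lemma linear_form_basis u : l u = \sum_i u i ord0 * l (basis_cV i).
Proof.
rewrite {1}[u]decompose_cV; elim/big_ind2: _ => //.
by move=> a v b w <- <-; rewrite -[v]scale1r l_lin mul1r scale1r.
Qed.

Lemma dyadic_quotient_remainder k e : enorm e <= 1 ->
  `|dyadic_quotient F k e - l e| <= 2 ^- k * G.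
Proof.
move=> e1; have k0 : (0 : R) < 2 ^+ k by rewrite exprn_gt0.
have k1 : 0 < 2 ^- k :> R by rewrite invr_gt0.
have kk : 2 ^- k <= 1 :> R by rewrite invf_le1// exprn_ege1// ler1n.
have se : enorm (2 ^- k *: e) = 2 ^- k * enorm e by rewrite enormZ gtr0_norm.
have := F_taylor (u := 2 ^- k *: e); rewrite se lZ => h.
have {}h := h (mulr_ile1 (ltW k1) (enorm_ge0 _) kk e1).
rewrite (_ : _ - l e = 2 ^+ k * (F (2 ^- k *: e) - F 0 - 2 ^- k * l e)); last first.
  by rewrite /dyadic_quotient; field; rewrite gt_eqF.
rewrite normrM gtr0_norm//; apply: le_trans (ler_wpM2l (ltW k0) h) _.
rewrite [leLHS](_ : _ = 2 ^- k * (enorm e ^+ 2 * G)); last first.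
  by move: (gt_eqF k0); move: (2 ^+ k) => w w0; field; rewrite w0.
by rewrite ler_wpM2l ?(ltW k1)// ler_piMl// expr_le1// enorm_ge0.
Qed.

(** The linear part l cancels here and in dyadic_quotient_taylor: both bounds
    concern values of F only, and therefore make sense for kernels, for which no
    linear part is known beforehand. *)
Lemma dyadic_quotient_increment k e : enorm e <= 1 ->
  `|dyadic_quotient F k.+1 e - dyadic_quotient F k e| <= 2 ^- k * (2 * G).
Proof.
move=> e1; have h1 := dyadic_quotient_remainder k e1.
have h2 := dyadic_quotient_remainder k.+1 e1.
rewrite (_ : _ - _ = (dyadic_quotient F k.+1 e - l e) - (dyadic_quotient F k e - l e));
  last by ring.
apply: le_trans (ler_normB _ _) _; apply: le_trans (lerD h2 h1) _.
have k1 : 0 < 2 ^- k :> R by rewrite invr_gt0 exprn_gt0.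
rewrite exprS invfM; have : 0 <= 2 ^- k * G by rewrite mulr_ge0// ltW.
by lra.
Qed.

Lemma dyadic_quotient_taylor k u : enorm u <= 1 ->
  `|F u - F 0 - \sum_i u i ord0 * dyadic_quotient F k (basis_cV i)|
  <= (enorm u ^+ 2 + n%:R * 2 ^- k) * G.
Proof.
move=> u1; have -> : F u - F 0 - \sum_i u i ord0 * dyadic_quotient F k (basis_cV i) =
   (F u - F 0 - l u) -
   \sum_i u i ord0 * (dyadic_quotient F k (basis_cV i) - l (basis_cV i)).
  under [in RHS]eq_bigr do rewrite mulrBr.
  by rewrite sumrB -linear_form_basis; ring.
apply: le_trans (ler_normB _ _) _; rewrite mulrDl lerD//; first exact: F_taylor.
apply: le_trans (ler_norm_sum _ _ _) _.
apply: (@le_trans _ _ (\sum_(i < n) 2 ^- k * G)); last first.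
  by rewrite sumr_const card_ord -[_ *+ n]mulr_natl mulrA.
apply: ler_sum => i _; rewrite normrM -[leRHS]mul1r ler_pM//.
  exact: le_trans (ler_coord_enorm _ _) u1.
by apply: dyadic_quotient_remainder; rewrite enorm_basis.
Qed.

End pointwise.
End difference_quotients.

(** * The Gaussian density *)

Section exponential_remainder.
Context {R : realType}.

Lemma expR_ge1 (t : R) : 0 <= t -> 1 <= expR t.
Proof. by move=> t0; apply: le_trans (expR_ge1Dx t); rewrite lerDl. Qed.

Lemma expR_remainder2 (s : R) : `|expR s - 1 - s| <= s ^+ 2 * expR `|s|.
Proof.
have lo : 0 <= expR s - 1 - s by have := expR_ge1Dx s; lra.
rewrite ger0_norm//; have up : expR s - 1 <= s * expR s.
  have := ler_wpM2l (expR_ge0 s) (expR_ge1Dx (- s)).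
  by rewrite expRN divff ?gt_eqF ?expR_gt0//; lra.
apply: (@le_trans _ _ (s * (expR s - 1))); first by lra.
have [s0|s0] := leP 0 s.
  by rewrite expr2 -mulrA ger0_norm// ler_wpM2l.
apply: (@le_trans _ _ (s ^+ 2)).
  by rewrite expr2 -subr_ge0 -mulrBr nmulr_rge0//; have := expR_ge1Dx s; lra.
by rewrite ler_peMr ?sqr_ge0// expR_ge1.
Qed.

Lemma sqr_le_expR (t : R) : 0 <= t -> t ^+ 2 <= 4 * expR t.
Proof.
move=> t0; have h := expR_ge1Dx (t / 2).
have : (1 + t / 2) ^+ 2 <= expR t.
  rewrite [in expR t](_ : t = 2%:R * (t / 2)); last by field.
  by rewrite expRM_natl ler_pXn2r ?nnegrE ?expR_ge0//; lra.
by nra.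
Qed.

End exponential_remainder.

Section gaussian.
Context {R : realType} {n : nat}.
Implicit Types (x u : 'cV[R]_n).

Definition gauss_tail (a : R) x : R := expR (- (a * dot x x)).

Lemma measurable_dot d (T : measurableType d) (f g : T -> 'cV[R]_n) :
  measurable_fun setT f -> measurable_fun setT g ->
  measurable_fun setT (fun t => dot (f t) (g t)).
Proof.
move=> mf mg; have := measurable_dot_mulmx (1%:M) mf mg.
by under eq_fun do rewrite mul1mx.
Qed.

Lemma measurable_gauss_tail a : measurable_fun setT (gauss_tail a).
Proof.
apply: measurableT_comp => //; apply: measurableT_comp => //.
by apply: measurable_funM => //; exact: measurable_dot.
Qed.

Lemma integral_gauss_tail_lty a : 0 < a ->
  (\int[lebesgue_cV n]_x (gauss_tail a x)%:E < +oo)%E.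
Proof.
move=> a0; pose f (t : R) := expR (- (a * t ^+ 2)).
have mf : measurable_fun setT f.
  apply: measurableT_comp => //; apply: measurableT_comp => //.
  by apply: measurable_funM => //; exact: measurable_funX.
have -> : (fun x => (gauss_tail a x)%:E) =
    (fun x => (\prod_(i < n) f (x i ord0))%:E).
  apply/funext => x; rewrite /gauss_tail /f -expR_sum; congr (expR _)%:E.
  by rewrite /dot mulr_sumr -sumrN.
rewrite lebesgue_cV_prod//; last by move=> t; exact: expR_ge0.
have := integral_gauss_lty a0.
have : (0 <= \int[lebesgue_measure]_t (f t)%:E)%E.
  by apply: integral_ge0 => t _; rewrite lee_fin expR_ge0.
rewrite -/f => i0 ioo.
have ifin : (\int[lebesgue_measure]_t (f t)%:E)%E \is a fin_num by rewrite ge0_fin_numE.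
by rewrite -(fineK ifin) -EFin_expe ltry.
Qed.

Section density.
Variables (C : 'M[R]_n) (c : R).
Hypothesis c0 : 0 < c.
Hypothesis Cc : forall x, c * enorm x ^+ 2 <= dot (C *m x) x.

Local Notation P := (invmx C).
Local Notation q := (gaussian_density C).
Local Notation Z := (Num.sqrt ((2 * pi) ^+ n * \det C)).

Lemma invmx_bounded_below :
  exists2 a, 0 < a & forall x, a * enorm x ^+ 2 <= dot (P *m x) x.
Proof.
have uC := bounded_below_unitmx c0 Cc.
pose S := entry_sum C; have S1 : 0 < S ^+ 2 + 1 by rewrite ltr_wpDl// sqr_ge0.
exists (c / (S ^+ 2 + 1)) => [|x]; first exact: divr_gt0.
pose y := P *m x; have xE : x = C *m y by rewrite /y mulmxA mulmxV// mul1mx.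
have h := enorm_mulmx C y; rewrite -xE -/S in h.
have -> : dot (P *m x) x = dot (C *m y) y by rewrite dotC -xE.
apply: le_trans (Cc y); rewrite mulrAC ler_pdivrMr// -mulrA ler_pM2l//.
have := enorm_ge0 x; have := enorm_ge0 y; have := entry_sum_ge0 C; rewrite -/S.
move=> S0 y0 x0; apply: (@le_trans _ _ ((S * enorm y) ^+ 2)).
  by rewrite ler_pXn2r// nnegrE mulr_ge0.
by rewrite exprMn mulrDr mulr1 mulrC lerDl sqr_ge0.
Qed.

Lemma measurable_gaussian_density : measurable_fun setT q.
Proof.
apply: measurable_funM => //; apply: measurableT_comp => //.
apply: measurable_funM => //; apply: measurableT_comp => //.
exact: measurable_dot_mulmx.
Qed.

Lemma gaussian_density_ge0 x : 0 <= q x.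
Proof. by rewrite divr_ge0 ?expR_ge0 ?sqrtr_ge0. Qed.

Lemma gaussian_density_tail : exists K a : R,
  [/\ 0 <= K, 0 < a & forall x, q x <= K * gauss_tail a x].
Proof.
have [a a0 Pa] := invmx_bounded_below.
exists Z^-1, (a / 2); split; rewrite ?invr_ge0 ?sqrtr_ge0//; first exact: divr_gt0.
move=> x; rewrite mulrC ler_wpM2r ?invr_ge0 ?sqrtr_ge0// ler_expR.
by have := Pa x; rewrite sqr_enorm; lra.
Qed.

(** The quadratic Taylor remainder of the density is again Gaussian-small: the
    factor by which a unit shift changes the density grows at most
    exponentially in x, and is absorbed by a slightly slower Gaussian decay. *)
Lemma gaussian_density_taylor : exists (K a : R) (l : 'cV[R]_n -> 'cV[R]_n -> R),
  [/\ 0 <= K, 0 < a,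
      forall x b u v, l x (b *: u + v) = b * l x u + l x v &
      forall x u, enorm u <= 1 ->
        `|q (x - u) - q x - l x u| <= enorm u ^+ 2 * (K * gauss_tail a x)].
Proof.
have [a a0 Pa] := invmx_bounded_below.
pose S := entry_sum P; have S0 : 0 <= S := entry_sum_ge0 P.
pose B x u := dot (P *m x) u + dot (P *m u) x.
pose K := (4 * S ^+ 2 + S) * expR (2 * (S + 1)) * expR ((S + 1) ^+ 2 / a) / Z.
exists K, (a / 4), (fun x u => q x * (B x u / 2)); split.
- rewrite divr_ge0 ?sqrtr_ge0// !mulr_ge0 ?expR_ge0//.
  by rewrite addr_ge0// mulr_ge0// sqr_ge0.
- exact: divr_gt0.
- move=> x b u v; rewrite /B mulmxDr -scalemxAr !(dotDl, dotDr, dotZl, dotZr).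
  by field.
move=> x u u1.
(* The exponent of the Gaussian changes by s, which is of first order in u. *)
pose s := (B x u - dot (P *m u) u) / 2.
have qs : q (x - u) = q x * expR s.
  rewrite /gaussian_density mulrAC -expRD; congr (expR _ / _).
  by rewrite /s /B mulmxBr !(dotDl, dotDr, dotNl, dotNr); field.
have u0 := enorm_ge0 u; have x0 := enorm_ge0 x.
have Bb : `|B x u| <= 2 * (S * (enorm x * enorm u)).
  apply: le_trans (ler_normD _ _) _.
  have := normr_dot_mulmx P x u; have := normr_dot_mulmx P u x.
  by rewrite -/S [enorm u * _]mulrC; lra.
have Qb : `|dot (P *m u) u| <= S * (enorm u * enorm u) := normr_dot_mulmx P u u.
have sb : `|s| <= S * enorm u * (enorm x + 1).
  rewrite /s normrM [`|2^-1|]ger0_norm ?invr_ge0//.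
  have := ler_normB (B x u) (dot (P *m u) u).
  have : enorm u * enorm u <= enorm u by rewrite ler_piMl.
  have := ler_wpM2l S0 (ler_piMl u0 u1).
  by nra.
have sb1 : `|s| <= S * (enorm x + 1).
  apply: le_trans sb _; rewrite mulrAC ler_piMr//.
  by apply: mulr_ge0 => //; exact: addr_ge0.
pose E := expR (S * (enorm x + 1)).
have E1 : 1 <= E by apply: expR_ge1; apply: mulr_ge0 => //; exact: addr_ge0.
have rem : `|expR s - 1 - B x u / 2| <=
    enorm u ^+ 2 * ((4 * S ^+ 2 + S) * expR ((S + 1) * (enorm x + 1))).
  have -> : expR s - 1 - B x u / 2 = (expR s - 1 - s) - dot (P *m u) u / 2.
    by rewrite /s; field.
  apply: le_trans (ler_normB _ _) _.
  have h1 : `|expR s - 1 - s| <= (S * enorm u * (enorm x + 1)) ^+ 2 * E.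
    apply: le_trans (expR_remainder2 s) _; apply: ler_pM => //.
    - exact: sqr_ge0.
    - rewrite -(real_normK (num_real s)) ler_pXn2r// nnegrE.
      by rewrite !mulr_ge0// addr_ge0.
    - by rewrite ler_expR.
  have h2 : `|dot (P *m u) u / 2| <= S * enorm u ^+ 2.
    rewrite normrM [`|2^-1|]ger0_norm ?invr_ge0// expr2.
    by have := normr_ge0 (dot (P *m u) u); lra.
  apply: le_trans (lerD h1 h2) _.
  have h3 : (enorm x + 1) ^+ 2 <= 4 * expR (enorm x + 1) by apply: sqr_le_expR; exact: addr_ge0.
  have e3 : expR ((S + 1) * (enorm x + 1)) = E * expR (enorm x + 1).
    by rewrite -expRD; congr expR; ring.
  have e4 : 1 <= expR (enorm x + 1) by apply: expR_ge1; exact: addr_ge0.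
  rewrite e3; set y := expR _ in h3 e4 *.
  have h5 : (enorm x + 1) ^+ 2 * E <= 4 * (E * y).
    by rewrite mulrCA [leRHS]mulrC [4 * y * E]mulrC -mulrCA; nra.
  have h6 : 1 <= E * y by rewrite -[1]mulr1 ler_pM.
  rewrite !exprMn; set U := enorm u ^+ 2; have U0 : 0 <= U := sqr_ge0 _.
  have SU : 0 <= S * U by rewrite mulr_ge0.
  have SSU : 0 <= S ^+ 2 * U by rewrite mulr_ge0// sqr_ge0.
  have := lerD (ler_wpM2l SSU h5) (ler_wpM2l SU h6).
  rewrite [leRHS](_ : _ = U * ((4 * S ^+ 2 + S) * (E * y))); last by ring.
  by apply: le_trans; rewrite le_eqVlt; apply/orP; left; apply/eqP; ring.
rewrite qs (_ : _ - _ = q x * (expR s - 1 - B x u / 2)); last by ring.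
rewrite normrM ger0_norm ?gaussian_density_ge0//.
apply: le_trans (ler_wpM2l (gaussian_density_ge0 x) rem) _.
rewrite mulrCA ler_wpM2l ?sqr_ge0// /K /gauss_tail /gaussian_density.
rewrite [leLHS](_ : _ = (4 * S ^+ 2 + S) / Z *
  (expR (- dot (P *m x) x / 2) * expR ((S + 1) * (enorm x + 1)))); last by ring.
rewrite [leRHS](_ : _ = (4 * S ^+ 2 + S) / Z *
  (expR (2 * (S + 1)) * expR ((S + 1) ^+ 2 / a) * expR (- (a / 4 * dot x x)))); last by ring.
rewrite ler_wpM2l//.
  by rewrite divr_ge0 ?sqrtr_ge0// addr_ge0// mulr_ge0// sqr_ge0.
rewrite -!expRD ler_expR -sqr_enorm.
have := Pa x; set X := enorm x; move=> PaX.
have h : (S + 1) * X <= a / 4 * X ^+ 2 + (S + 1) ^+ 2 / a.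
  rewrite -subr_ge0 (_ : _ - _ = ((a / 2 * X - (S + 1)) ^+ 2) / a); last first.
    by field; rewrite gt_eqF.
  by rewrite divr_ge0 ?sqr_ge0// ltW.
by lra.
Qed.

End density.
End gaussian.

(** * Densities of image measures *)

Lemma Lfun1_integrableS d (T : measurableType d) (R : realType)
    (m : {measure set T -> \bar R}) (f : T -> R) (A : set T) :
  measurable A -> f \in Lfun m 1%E -> m.-integrable A (EFin \o f).
Proof.
by move=> mA /Lfun1_integrable; apply: integrableS (measurableT) _ _.
Qed.

Section image_density.
Context d1 d2 {X : measurableType d1} {T : measurableType d2} {R : realType}.
Variables (lam : {measure set X -> \bar R}) (m : {measure set T -> \bar R}).
Variable phi : X -> T.
Hypothesis mphi : measurable_fun setT phi.
Implicit Types (p : X -> R) (f : T -> R).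

(** A signed version of is_density for image measures: it is stable under linear
    combinations, and so applies to difference quotients of kernels. *)
Definition image_density p f :=
  [/\ p \in Lfun lam 1%E, f \in Lfun m 1%E &
      forall B, measurable B ->
        \int[m]_(y in B) f y = \int[lam]_(x in phi @^-1` B) p x].

Let mpre B : measurable B -> measurable (phi @^-1` B).
Proof. by move=> mB; rewrite -[X in measurable X]setTI; exact: mphi. Qed.

Lemma image_densityD p1 p2 f1 f2 : image_density p1 f1 -> image_density p2 f2 ->
  image_density (fun x => p1 x + p2 x) (fun y => f1 y + f2 y).
Proof.
move=> [p1L f1L h1] [p2L f2L h2]; split; [exact: Lfun1D|exact: Lfun1D|].
move=> B mB; rewrite !RintegralD ?h1 ?h2//; try exact: mpre;
  by apply: Lfun1_integrableS => //; exact: mpre.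
Qed.

Lemma image_densityZ c p f : image_density p f ->
  image_density (fun x => c * p x) (fun y => c * f y).
Proof.
move=> [pL fL h]; split; [exact: Lfun1Z|exact: Lfun1Z|].
move=> B mB; rewrite !RintegralZl ?h//; try exact: mpre;
  by apply: Lfun1_integrableS => //; exact: mpre.
Qed.

Lemma image_densityB p1 p2 f1 f2 : image_density p1 f1 -> image_density p2 f2 ->
  image_density (fun x => p1 x - p2 x) (fun y => f1 y - f2 y).
Proof.
move=> h1 h2; have := image_densityD h1 (image_densityZ (- 1) h2).
by under eq_fun do rewrite mulN1r; under [X in image_density _ X]eq_fun do rewrite mulN1r.
Qed.

Lemma image_density_sum n (p : 'I_n -> X -> R) (f : 'I_n -> T -> R) :
  (forall i, image_density (p i) (f i)) ->
  image_density (fun x => \sum_i p i x) (fun y => \sum_i f i y).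
Proof.
move=> h; split; [by apply: Lfun1_sum => i; case: (h i)..|].
move=> B mB.
suff H (s : seq 'I_n) : image_density (fun x => \sum_(i <- s) p i x)
    (fun y => \sum_(i <- s) f i y) by case: (H (index_enum _)) => _ _; exact.
elim: s => [|i s ih].
  under eq_fun do rewrite big_nil; under [X in image_density _ X]eq_fun do rewrite big_nil.
  by split; [exact: Lfun1_0..|move=> C mC; rewrite /Rintegral !integral0].
under eq_fun do rewrite big_cons; under [X in image_density _ X]eq_fun do rewrite big_cons.
exact: image_densityD.
Qed.

Lemma image_density_mean p f : image_density p f -> \int[m]_y f y = \int[lam]_x p x.
Proof. by move=> [_ _ h]; rewrite h// preimage_setT. Qed.

(** On the set where f is nonnegative and on its complement, the integral of
    |f| is that of p over the preimage, up to sign. *)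
Lemma image_density_contraction p f : image_density p f ->
  (L1norm m f <= L1norm lam p)%E.
Proof.
move=> [pL fL h]; have mf := Lfun1_measurable fL; have mp := Lfun1_measurable pL.
pose B := [set y | 0 <= f y].
have mB : measurable B.
  rewrite (_ : B = f @^-1` `[0, +oo[); last first.
    by apply/seteqP; split => y /=; rewrite in_itv/= andbT.
  by rewrite -[X in measurable X]setTI; exact: mf.
have iS A : measurable A -> m.-integrable A (EFin \o f).
  by move=> mA; exact: Lfun1_integrableS.
have iSl A : measurable A -> lam.-integrable A (EFin \o p).
  by move=> mA; exact: Lfun1_integrableS.
have bound A (e : R) : `|e| = 1 -> measurable A -> (forall y, A y -> `|f y| = e * f y) ->
    (\int[m]_(y in A) `|f y|%:E <= \int[lam]_(x in phi @^-1` A) `|p x|%:E)%E.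
  move=> e1 mA fA.
  have -> : (\int[m]_(y in A) `|f y|%:E = (e * \int[m]_(y in A) f y)%:E)%E.
    rewrite -RintegralZl//; last exact: iS.
    rewrite /Rintegral fineK.
      by apply: eq_integral => y; rewrite inE => Ay; rewrite fA.
    apply: integrable_fin_num => //.
    by have := integrableZl mA e (iS _ mA).
  rewrite h//; apply: (@le_trans _ _ (`|e * \int[lam]_(x in phi @^-1` A) p x|%:E)).
    by rewrite lee_fin ler_norm.
  rewrite normrM e1 mul1r EFin_normr_Rintegral; [|exact: mpre|exact/iSl/mpre].
  by apply: le_abse_integral; [exact: mpre|exact: measurable_int (iSl _ (mpre mA))].
rewrite !L1normE -(setUv B) ge0_integral_setU//=; last 3 first.
- exact: measurableC.
- by rewrite setUv; exact: measurable_normE.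
- by apply/disj_setPS; rewrite setICr.
have -> : (\int[lam]_x `|p x|%:E = \int[lam]_(x in phi @^-1` B `|` phi @^-1` (~` B)) `|p x|%:E)%E.
  by rewrite -preimage_setU setUv preimage_setT.
rewrite ge0_integral_setU//=; last 4 first.
- exact: mpre.
- by apply: mpre; exact: measurableC.
- by rewrite -preimage_setU setUv preimage_setT; exact: measurable_normE.
- by apply/disj_setPS => x [/= ? ?].
apply: leeD.
  by apply: (bound _ 1) => // [|y By]; [rewrite normr1|rewrite mul1r ger0_norm].
apply: (bound _ (-1)) => // [||y]; first by rewrite normrN1.
  exact: measurableC.
by move=> /negP; rewrite -ltNge => fy; rewrite mulN1r ltr0_norm.
Qed.

Lemma is_density_image p f : (forall x, 0 <= p x) -> p \in Lfun lam 1%E ->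
  is_density m (pushforward (fun A => \int[lam]_(x in A) (p x)%:E)%E phi) f ->
  image_density p f.
Proof.
move=> p0 pL [mf f0 h].
have fL : f \in Lfun m 1%E.
  apply/Lfun1P; split => //; rewrite L1normE.
  rewrite (_ : (\int[m]_y _ = \int[m]_y (f y)%:E)%E); last first.
    apply: ae_eq_integral => //; [exact: measurable_normE|exact/measurable_EFinP|].
    by apply: filterS f0 => y f0 _; rewrite ger0_norm.
  rewrite -h// /pushforward preimage_setT.
  have /Lfun1P[_] := pL; rewrite L1normE; apply: le_lt_trans.
  rewrite le_eqVlt; apply/orP; left; apply/eqP; apply: eq_integral => x _.
  by rewrite ger0_norm.
by split => // B mB; rewrite /Rintegral -h.
Qed.

End image_density.

(** * The folding map *)

Section folding_map.
Context {R : realType}.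
Implicit Types a b s : R.

Lemma measurable_folding a b : measurable_fun setT (folding a b).
Proof.
have mfloor : measurable_fun setT (fun s : R => (Num.floor s)%:~R : R).
  apply: nondecreasing_measurable => // s t st.
  by rewrite ler_int le_floor.
apply: measurable_funB => //; apply: measurableT_comp => //.
apply: measurable_funB => //; apply: measurable_funB; first exact: measurable_funB.
apply: measurable_funM => //; apply: (measurableT_comp mfloor).
by apply: measurable_funM => //; exact: measurable_funB.
Qed.

Lemma folding_id a b s : a < b -> a <= s <= b -> folding a b s = s.
Proof.
move=> ab /andP[sa sb]; rewrite /folding /rmod.
have -> : Num.floor ((s - a) / (2 * (b - a))) = 0.
  apply: floor_def; rewrite mulr0z/= divr_ge0 ?subr_ge0//= ?mulr_ge0 ?subr_ge0 ?ltW//.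
  by rewrite ltr_pdivrMr; lra.
by rewrite mulr0z mulr0 subr0 ler0_norm; lra.
Qed.

Lemma measurable_folding_cV a b d : measurable_fun setT (@folding_cV R a b d).
Proof.
apply: measurable_cVP => i; under eq_fun do rewrite mxE.
apply: (measurableT_comp (measurable_folding a b)).
exact: measurable_coord.
Qed.

Lemma folding_cV_id a b d (x : 'cV[R]_d) : a < b -> cube a b x -> folding_cV a b x = x.
Proof. by move=> ab xab; apply/colP => i; rewrite mxE folding_id. Qed.

End folding_map.

Section translates.
Context {R : realType} {n : nat}.
Local Notation lam := (@lebesgue_cV R n).
Implicit Types (f : 'cV[R]_n -> R) (z : 'cV[R]_n).

Lemma measurable_translate f z : measurable_fun setT f ->
  measurable_fun setT (fun x : 'cV[R]_n => f (x - z)).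
Proof. by move=> mf; apply: (measurableT_comp mf); exact: measurable_cVB. Qed.

Lemma L1norm_translate f z : measurable_fun setT f ->
  L1norm lam (fun x => f (x - z)) = L1norm lam f.
Proof.
move=> mf; rewrite !L1normE.
rewrite -[RHS](lebesgue_cV_shift (f := fun x => `|f x|%:E) (- z))//.
exact: measurable_normE.
Qed.

End translates.

(** * The reflected Gaussian kernel *)

Section reflected_kernel.
Context {R : realType} {d : nat}.
Variables (a b h : R) (Sigma : 'M[R]_d) (c : R).
Hypothesis ab : a < b.
Local Notation V := 'cV[R]_d.
Local Notation lam := (@lebesgue_cV R d).
Local Notation m := (cube_measure a b d).
Local Notation q := (noise_density h Sigma).
Hypothesis c0 : 0 < c.
Hypothesis covc : forall x : V, c * enorm x ^+ 2 <= dot ((h *: (Sigma *m Sigma^T)) *m x) x.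
Variable kern : V -> V -> R.
Hypothesis hkern : is_reflected_kernel a b h Sigma kern.

Let mq : measurable_fun setT q := measurable_gaussian_density _.
Let q0 x : 0 <= q x := gaussian_density_ge0 _ x.

Lemma noise_density_Lfun1 : q \in Lfun lam 1%E.
Proof.
have [K [s [K0 s0 qK]]] := gaussian_density_tail c0 covc.
apply/Lfun1P; split => //.
apply: (@le_lt_trans _ _ (\int[lam]_x (K%:E * (gauss_tail s x)%:E))%E).
  apply: L1norm_le_integral => //.
  - by apply: measurable_funeM; apply/measurable_EFinP; exact: measurable_gauss_tail.
  - by move=> x; rewrite lee_fin mulr_ge0// expR_ge0.
  - by apply: aeW => x; rewrite ger0_norm// -EFinM lee_fin; exact: qK.
rewrite ge0_integralZl//; last 2 first.
- by apply/measurable_EFinP; exact: measurable_gauss_tail.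
- by move=> x _; rewrite lee_fin expR_ge0.
by rewrite lte_mul_pinfty//; exact: integral_gauss_tail_lty.
Qed.

Lemma kern_image z : image_density lam m (@folding_cV R a b d)
  (fun x => q (x - z)) (kern z).
Proof.
apply: is_density_image => //; last exact: (hkern.2 z).
apply/Lfun1P; split; first exact: measurable_translate.
by rewrite L1norm_translate//; case/Lfun1P: noise_density_Lfun1.
Qed.

Lemma kern_Lfun1 z : kern z \in Lfun m 1%E.
Proof. by case: (kern_image z). Qed.

Lemma kern_ge0 z : {ae m, forall y, 0 <= kern z y}.
Proof. by case: hkern => _ /(_ z)[]. Qed.

(** Folding preserves mass, and Lebesgue measure is invariant by translation. *)
Lemma kern_L1norm z : L1norm m (kern z) = L1norm lam q.
Proof.
rewrite (L1norm_mean (kern_Lfun1 z) (kern_ge0 z)).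
rewrite -(L1norm_translate z mq) (image_density_mean (kern_image z)).
by rewrite L1norm_mean//; [case: (kern_image z)|exact: aeW].
Qed.

Lemma kern_mean z : \int[m]_y kern z y = fine (L1norm lam q).
Proof.
by rewrite -(kern_L1norm z) (L1norm_mean (kern_Lfun1 z) (kern_ge0 z)).
Qed.

Lemma measurable_kern2 e (T : measurableType e) (f g : T -> V) :
  measurable_fun setT f -> measurable_fun setT g ->
  measurable_fun setT (fun t => kern (f t) (g t)).
Proof.
move=> mf mg; have [mk _] := hkern.
exact: (measurableT_comp mk (measurable_fun_pair mf mg)).
Qed.

Lemma measurable_kern z : measurable_fun setT (kern z).
Proof. exact: Lfun1_measurable (kern_Lfun1 z). Qed.

(** * Differentiability of the kernel in L1 *)

Definition kern_quotient k z e y : R := dyadic_quotient (fun u => kern (z + u) y) k e.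

(** The limit is taken in the pair (z, y): for each z an L1 limit would only give
    a class of functions of y, with no control on the dependence on z. *)
Definition partial_kern i z y : R :=
  pw_limit (fun k p => kern_quotient k p.1 (basis_cV i) p.2) (z, y).

Definition kern_derivative z (u : V) y : R := \sum_i u i ord0 * partial_kern i z y.

Lemma kern_quotient_image k z e : image_density lam m (@folding_cV R a b d)
  (fun x => dyadic_quotient (fun u => q (x - (z + u))) k e) (kern_quotient k z e).
Proof.
have mf := @measurable_folding_cV R a b d.
apply: (image_densityZ mf); apply: (image_densityB mf); exact: kern_image.
Qed.

Lemma kern_quotient_Lfun1 k z e : kern_quotient k z e \in Lfun m 1%E.
Proof. by case: (kern_quotient_image k z e). Qed.

Lemma kern_quotient_mean k z e : \int[m]_y kern_quotient k z e y = 0.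
Proof.
rewrite /kern_quotient /dyadic_quotient Lfun1_meanZ; last first.
  by apply: Lfun1B; exact: kern_Lfun1.
rewrite Lfun1_meanB; [|exact: kern_Lfun1..].
by rewrite !kern_mean subrr mulr0.
Qed.

Lemma measurable_partial_kern i :
  measurable_fun setT (fun p : V * V => partial_kern i p.1 p.2).
Proof.
rewrite (_ : (fun _ => _) = pw_limit (fun k (p : V * V) =>
    kern_quotient k p.1 (basis_cV i) p.2)); last by apply/funext => -[].
apply: measurable_pw_limit => k; apply: measurable_funM => //.
by apply: measurable_funB; apply: measurable_kern2 => //; exact: measurable_cVD.
Qed.

Lemma measurable_partial_kern_section i z : measurable_fun setT (partial_kern i z).
Proof.
exact: (measurableT_comp (measurable_partial_kern i) (measurable_pair1 z)).
Qed.

Lemma measurable_kern_derivative :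
  measurable_fun setT (fun p : V * V * V => kern_derivative p.1.1 p.1.2 p.2).
Proof.
apply: measurable_sum => i; apply: measurable_funM.
  by apply: measurable_coord; apply: measurableT_comp.
apply: (measurableT_comp (measurable_partial_kern i)
  (measurable_fun_pair (f := fun p : V * V * V => p.1.1) (g := fun p => p.2) _ _)) => //.
  exact: measurableT_comp.
exact: measurable_snd.
Qed.

Lemma measurable_kern_derivative_section z u :
  measurable_fun setT (kern_derivative z u).
Proof.
apply: measurable_sum => i; apply: measurable_funM => //.
exact: measurable_partial_kern_section.
Qed.

Lemma kern_derivative_linear z s u v y :
  kern_derivative z (s *: u + v) y = s * kern_derivative z u y + kern_derivative z v y.
Proof.
rewrite /kern_derivative mulr_sumr -big_split; apply: eq_bigr => i _.
by rewrite !mxE/=; ring.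
Qed.

(** More than Frechet differentiability: the remainder is quadratic, and the
    constant is the same at all points z, hence for all times of the chain. *)
Definition uniform_derivative (G : R) (D : V -> V -> V -> R) := forall z u,
  [/\ measurable_fun setT (D z u),
      \int[m]_y D z u y = 0,
      (L1norm m (D z u) <= (G * enorm u)%:E)%E &
      enorm u <= 1 ->
      (L1norm m (fun y => kern (z + u) y - kern z y - D z u y)%R
        <= (G * enorm u ^+ 2)%:E)%E].

(** Integrating the pointwise Taylor bound for the Gaussian against a translate
    gives constants that do not depend on z; folding does not increase norms. *)
Section taylor_bounds.
Variables (g : V -> R) (l : V -> V -> R).
Hypothesis g0 : forall x, 0 <= g x.
Hypothesis gL : g \in Lfun lam 1%E.
Hypothesis l_lin : forall x s u v, l x (s *: u + v) = s * l x u + l x v.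
Hypothesis taylor : forall x u, enorm u <= 1 ->
  `|q (x - u) - q x - l x u| <= enorm u ^+ 2 * g x.

Let G := fine (L1norm lam g).
Let G0 : 0 <= G. Proof. by apply: fine_ge0; exact: L1norm_ge0. Qed.
Let Q := fine (L1norm lam q).
Let Q0 : 0 <= Q. Proof. by apply: fine_ge0; exact: L1norm_ge0. Qed.
Let mg : measurable_fun setT g := Lfun1_measurable gL.
Let mfold := @measurable_folding_cV R a b d.

Let taylor_translate z x u : enorm u <= 1 ->
  `|q (x - (z + u)) - q (x - (z + 0)) - l (x - z) u| <= enorm u ^+ 2 * g (x - z).
Proof. by move=> u1; rewrite addr0 opprD addrA; exact: taylor. Qed.

Lemma image_density_bound z p f e : 0 <= e ->
  image_density lam m (@folding_cV R a b d) p f ->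
  (forall x, `|p x| <= e * g (x - z)) -> (L1norm m f <= (e * G)%:E)%E.
Proof.
move=> e0 pf pg; apply: le_trans (image_density_contraction mfold pf) _.
have mgz := measurable_translate z mg.
rewrite EFinM -(Lfun1_fin gL) -(L1norm_translate z mg) -[e in leRHS]ger0_norm//.
rewrite -L1normZ//; apply: L1norm_le.
- by case: pf => /Lfun1_measurable.
- exact: measurable_funM.
- by apply: aeW => x; rewrite [leRHS]ger0_norm// mulr_ge0.
Qed.

Lemma partial_kern_quotient i z k :
  (L1norm m (fun y => partial_kern i z y - kern_quotient k z (basis_cV i) y)%R
   <= (4 * G * 2^-1 ^+ k)%:E)%E.
Proof.
have half01 : 0 <= (2^-1 : R) < 1 by lra.
have -> : 4 * G * 2^-1 ^+ k = (2 * G) * 2^-1 ^+ k / (1 - 2^-1) by field.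
apply: (@pw_limit_L1_geometric _ _ _ m (fun k y => kern_quotient k z (basis_cV i) y)) => //.
- exact: mulr_ge0.
- by move=> j; exact: Lfun1_measurable (kern_quotient_Lfun1 _ _ _).
move=> j; rewrite (_ : 2 * G * _ = 2 ^- j * 2 * G); last by rewrite exprVn; ring.
apply: (@image_density_bound z (fun x =>
    dyadic_quotient (fun u => q (x - (z + u))) j.+1 (basis_cV i) -
    dyadic_quotient (fun u => q (x - (z + u))) j (basis_cV i))).
- by rewrite mulr_ge0// invr_ge0 exprn_ge0.
- by apply: (image_densityB mfold); exact: kern_quotient_image.
move=> x; rewrite -mulrA.
apply: (dyadic_quotient_increment (l := l (x - z))) => //.
by move=> u; exact: taylor_translate.
by rewrite enorm_basis.
Qed.

Lemma partial_kern_Lfun1 i z : partial_kern i z \in Lfun m 1%E.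
Proof.
have mp := measurable_partial_kern_section i z.
have -> : partial_kern i z = (fun y => (partial_kern i z y -
    kern_quotient 0 z (basis_cV i) y) + kern_quotient 0 z (basis_cV i) y).
  by apply/funext => y; rewrite subrK.
apply: Lfun1D (kern_quotient_Lfun1 _ _ _).
apply: L1norm_boundW (partial_kern_quotient i z 0%N).
by apply: measurable_funB => //; exact: Lfun1_measurable (kern_quotient_Lfun1 _ _ _).
Qed.

Lemma partial_kern_mean i z : \int[m]_y partial_kern i z y = 0.
Proof.
apply/eqP; rewrite -normr_le0.
apply: (@le_geometric_limit _ _ (4 * G) 2^-1) => [|k]; first by lra.
rewrite addr0 -lee_fin; apply: le_trans (partial_kern_quotient i z k).
apply: le_trans (le_mean_L1norm (Lfun1B (partial_kern_Lfun1 i z) (kern_quotient_Lfun1 _ _ _))).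
rewrite Lfun1_meanB ?kern_quotient_mean ?subr0//; last exact: kern_quotient_Lfun1.
exact: partial_kern_Lfun1.
Qed.

Lemma partial_kern_bound i z :
  (L1norm m (partial_kern i z) <= (4 * G + (Q + Q))%:E)%E.
Proof.
have mp := measurable_partial_kern_section i z.
have mk := Lfun1_measurable (kern_quotient_Lfun1 0 z (basis_cV i)).
apply: (@le_trans _ _ (L1norm m (fun y => (partial_kern i z y -
    kern_quotient 0 z (basis_cV i) y)%R) + L1norm m (kern_quotient 0 z (basis_cV i)))%E).
  apply: L1norm_leD => //; first exact: measurable_funB.
  apply: aeW => y; rewrite -{1}[partial_kern i z y](subrK (kern_quotient 0 z (basis_cV i) y)).
  exact: ler_normD.
rewrite EFinD; apply: leeD.
  by have := partial_kern_quotient i z 0%N; rewrite expr0 mulr1.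
rewrite (@L1norm_eq _ _ _ _ _ (fun y => kern (z + 2 ^- 0 *: basis_cV i) y - kern (z + 0) y));
  last by move=> y; rewrite /kern_quotient /dyadic_quotient expr0 mul1r.
apply: le_trans (L1normB m (measurable_kern _) (measurable_kern _)) _.
by rewrite !kern_L1norm EFinD -Lfun1_fin// noise_density_Lfun1.
Qed.

Lemma kern_derivative_Lfun1 z u : kern_derivative z u \in Lfun m 1%E.
Proof. by apply: Lfun1_sum => i; apply: Lfun1Z; exact: partial_kern_Lfun1. Qed.

Lemma kern_derivative_mean z u : \int[m]_y kern_derivative z u y = 0.
Proof.
suff H (r : seq 'I_d) : \int[m]_y (\sum_(i <- r) u i ord0 * partial_kern i z y) = 0 by exact: H.
elim: r => [|i r ih].
  by under eq_Rintegral do rewrite big_nil; rewrite /Rintegral integral0.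
under eq_Rintegral do rewrite big_cons.
have pL j : (fun y => u j ord0 * partial_kern j z y) \in Lfun m 1%E.
  by apply: Lfun1Z; exact: partial_kern_Lfun1.
rewrite Lfun1_meanD; [|exact: pL|exact: Lfun1_sum].
by rewrite ih addr0 Lfun1_meanZ ?partial_kern_mean ?mulr0//; exact: partial_kern_Lfun1.
Qed.

Lemma kern_derivative_bound z u :
  (L1norm m (kern_derivative z u) <= (d%:R * (4 * G + (Q + Q)) * enorm u)%:E)%E.
Proof.
rewrite (_ : _ * enorm u = \sum_(i < d) enorm u * (4 * G + (Q + Q))); last first.
  by rewrite sumr_const card_ord -[_ *+ d]mulr_natl; ring.
have mp i := measurable_partial_kern_section i z.
apply: L1norm_sum => i; first exact: measurable_funM.
rewrite L1normZ// EFinM; apply: lee_pmul => //; first exact: L1norm_ge0.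
  by rewrite lee_fin ler_coord_enorm.
exact: partial_kern_bound.
Qed.

Lemma kern_derivative_taylor z u : enorm u <= 1 ->
  (L1norm m (fun y => kern (z + u) y - kern z y - kern_derivative z u y)%R
    <= (G * enorm u ^+ 2)%:E)%E.
Proof.
move=> u1; have kL := kern_Lfun1; have pL := partial_kern_Lfun1.
have qL k z e := kern_quotient_Lfun1 k z e.
have DL := kern_derivative_Lfun1 z u.
have remL : (fun y => kern (z + u) y - kern z y - kern_derivative z u y) \in Lfun m 1%E.
  by apply: Lfun1B => //; exact: Lfun1B.
have half01 : 0 <= (2^-1 : R) < 1 by lra.
apply: (@le_geometric_limit_L1norm _ _ _ m _ (d%:R * G + d%:R * (4 * G)) 2^-1) => // k.
pose S y := \sum_i u i ord0 * kern_quotient k z (basis_cV i) y.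
have SL : S \in Lfun m 1%E by apply: Lfun1_sum => i; apply: Lfun1Z; exact: qL.
pose E y := \sum_i u i ord0 * (partial_kern i z y - kern_quotient k z (basis_cV i) y).
have dL i : (fun y => partial_kern i z y - kern_quotient k z (basis_cV i) y) \in Lfun m 1%E.
  by apply: Lfun1B => //; exact: qL.
have EL : E \in Lfun m 1%E by apply: Lfun1_sum => i; exact: Lfun1Z.
have kSL : (fun y => kern (z + u) y - kern (z + 0) y - S y) \in Lfun m 1%E.
  by apply: Lfun1B => //; exact: Lfun1B.
apply: (@le_trans _ _ (L1norm m (fun y => (kern (z + u) y - kern (z + 0) y - S y)%R) +
    L1norm m E)%E).
  apply: (L1norm_leD (Lfun1_measurable remL) (Lfun1_measurable kSL) (Lfun1_measurable EL)).
  apply: aeW => y; rewrite [in leLHS](_ : _ - _ - _ = (kern (z + u) y - kern (z + 0) y - S y) - E y).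
    exact: ler_normB.
  rewrite addr0 /E; under [in RHS]eq_bigr do rewrite mulrBr.
  by rewrite sumrB /S /kern_derivative; ring.
have -> : (d%:R * G + d%:R * (4 * G)) * 2^-1 ^+ k + G * enorm u ^+ 2 =
   (enorm u ^+ 2 + d%:R * 2 ^- k) * G + \sum_(i < d) 1 * (4 * G * 2^-1 ^+ k).
  by rewrite sumr_const card_ord -[_ *+ d]mulr_natl exprVn; ring.
rewrite EFinD; apply: leeD.
  apply: (@image_density_bound z (fun x => q (x - (z + u)) - q (x - (z + 0)) -
    \sum_i u i ord0 * dyadic_quotient (fun u => q (x - (z + u))) k (basis_cV i))).
  - by rewrite addr_ge0 ?sqr_ge0// mulr_ge0// ?ler0n// invr_ge0 exprn_ge0.
  - apply: (image_densityB mfold); first by apply: (image_densityB mfold); exact: kern_image.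
    apply: (image_density_sum mfold) => i; apply: (image_densityZ mfold).
    exact: kern_quotient_image.
  - move=> x; apply: (dyadic_quotient_taylor (F := fun u => q (x - (z + u))) (l := l (x - z))) => //.
    by move=> v; exact: taylor_translate.
apply: L1norm_sum => i.
  by apply: measurable_funM => //; exact: Lfun1_measurable (dL i).
rewrite L1normZ; last exact: Lfun1_measurable (dL i).
rewrite EFinM; apply: lee_pmul => //; first exact: L1norm_ge0.
  by rewrite lee_fin (le_trans (ler_coord_enorm _ _)).
exact: partial_kern_quotient.
Qed.

End taylor_bounds.

Lemma kern_derivative_uniform : exists2 G, 0 <= G & uniform_derivative G kern_derivative.
Proof.
have [K [s [l [K0 s0 l_lin taylor]]]] := gaussian_density_taylor c0 covc.
pose g (x : V) := K * gauss_tail s x.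
have g0 x : 0 <= g x by rewrite mulr_ge0// expR_ge0.
have gL : g \in Lfun lam 1%E.
  apply: Lfun1Z; apply/Lfun1P; split; first exact: measurable_gauss_tail.
  rewrite L1normE; under eq_integral do rewrite ger0_norm ?expR_ge0//.
  exact: integral_gauss_tail_lty.
pose G := fine (L1norm lam g); pose Q := fine (L1norm lam q).
have G0 : 0 <= G by apply: fine_ge0; exact: L1norm_ge0.
have Q0 : 0 <= Q by apply: fine_ge0; exact: L1norm_ge0.
have b0 : 0 <= d%:R * (4 * G + (Q + Q)).
  by rewrite mulr_ge0// ?ler0n// !addr_ge0// mulr_ge0.
exists (G + d%:R * (4 * G + (Q + Q))); first exact: addr_ge0.
move=> z u; split.
- exact: measurable_kern_derivative_section.
- exact: (kern_derivative_mean g0 gL l_lin taylor).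
- apply: le_trans (kern_derivative_bound g0 gL l_lin taylor z u) _.
  by rewrite lee_fin ler_wpM2r ?enorm_ge0// lerDr.
- move=> u1; apply: le_trans (kern_derivative_taylor g0 gL l_lin taylor z u1) _.
  by rewrite lee_fin ler_wpM2r ?sqr_ge0// lerDl.
Qed.

End reflected_kernel.

(** * Frechet derivatives of the kernel are unique *)

Section neighborhoods.
Context {R : realType} {n : nat}.
Local Notation V := 'cV[R]_n.

Lemma enorm_near0 (e : R) : 0 < e -> \forall u \near (0 : V), enorm u <= e.
Proof.
move=> e0; have n0 : (0 : R) < n.+1%:R by rewrite ltr0n.
apply/nbhs_ballP; exists (e / n.+1%:R) => /=; first exact: divr_gt0.
move=> u [_ hu]; apply: le_trans (enorm_le_sum u) _.
apply: (@le_trans _ _ (\sum_(i < n) e / n.+1%:R)).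
  apply: ler_sum => i _; have := hu i ord0.
  by rewrite /ball/= mxE sub0r normrN => /ltW.
rewrite sumr_const card_ord -[_ *+ n]mulr_natr mulrAC ler_pdivrMr//.
by rewrite ler_pM2l// ler_nat.
Qed.

Lemma near0_line (P : V -> Prop) u : (\forall v \near (0 : V), P v) ->
  exists2 s0 : R, 0 < s0 & forall s, 0 < s <= s0 -> P (s *: u).
Proof.
move=> /nbhs_ballP[r /= r0 rP]; have u1 : 0 < enorm u + 1.
  by rewrite ltr_wpDl// enorm_ge0.
exists (r / (enorm u + 1) / 2) => [|s /andP[s0 sr]]; first by rewrite !divr_gt0.
apply: rP; split => // i j; rewrite /ball/= !mxE sub0r normrN normrM gtr0_norm//.
rewrite (ord1 j); apply: (@le_lt_trans _ _ (s * (enorm u + 1))).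
  by rewrite ler_wpM2l ?(ltW s0)// (le_trans (ler_coord_enorm _ _))// lerDl.
apply: (@le_lt_trans _ _ (r / (enorm u + 1) / 2 * (enorm u + 1))).
  by rewrite ler_wpM2r// ltW.
by rewrite mulrAC divfK ?gt_eqF// ltr_pdivrMr// ltr_pMr// ltr1n.
Qed.

End neighborhoods.

Section derivative.
Context {R : realType} {d : nat}.
Variables (a b : R).
Local Notation V := 'cV[R]_d.
Local Notation m := (cube_measure a b d).
Variable kern : V -> V -> R.
Hypothesis mkern : forall z, measurable_fun setT (kern z).
Variables (G : R) (D : V -> V -> V -> R).
Hypothesis G0 : 0 <= G.
Hypothesis uD : uniform_derivative a b kern G D.
Hypothesis D_lin : forall z s u v y, D z (s *: u + v) y = s * D z u y + D z v y.

Let mD z u : measurable_fun setT (D z u). Proof. by case: (uD z u). Qed.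

Lemma uniform_derivative_frechet :
  measurable_fun setT (fun p : V * V * V => D p.1.1 p.1.2 p.2) ->
  is_kernel_derivative a b kern D.
Proof.
move=> mD3; split=> // z; split.
- move=> u; have [mDu _ Db _] := uD z u; exact: L1norm_boundW Db.
- by move=> c u v; apply: aeW => y; exact: D_lin.
- by exists G => u; case: (uD z u).
move=> e e0; have Ge : 0 < Num.min 1 (e / (G + 1)).
  by rewrite lt_min ltr01 divr_gt0// ltr_wpDl.
near=> u; have [_ _ _ taylor] := uD z u.
have : enorm u <= Num.min 1 (e / (G + 1)) by near: u; exact: enorm_near0.
rewrite le_min => /andP[u1 ue]; apply: le_trans (taylor u1) _.
rewrite lee_fin expr2 mulrA ler_wpM2r ?enorm_ge0//.
apply: (@le_trans _ _ ((G + 1) * (e / (G + 1)))).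
  by apply: ler_pM => //; [exact: enorm_ge0|rewrite lerDl].
by rewrite mulrC divfK// gt_eqF// ltr_wpDl.
Unshelve. all: by end_near. Qed.

(** Both derivatives approximate the increments of the kernel along the ray
    through u, hence their difference, being linear in u, is of smaller order
    than itself. *)
Lemma kernel_derivative_unique D' z u : is_kernel_derivative a b kern D' ->
  {ae m, forall y, D' z u y = D z u y}.
Proof.
move=> [_ /(_ z)[D'L D'lin _ D'taylor]].
have mD' v : measurable_fun setT (D' z v) := Lfun1_measurable (D'L v).
have DL : D z u \in Lfun m 1%E.
  by have [mDu _ Db _] := uD z u; exact: L1norm_boundW Db.
have dL : (fun y => D' z u y - D z u y) \in Lfun m 1%E by exact: Lfun1B.
suff : (L1norm m (fun y => (D' z u y - D z u y)%R) <= 0%:E)%E.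
  move=> /(L1norm_eq0 (Lfun1_measurable dL)); apply: filterS => y /eqP.
  by rewrite subr_eq0 => /eqP.
rewrite (Lfun1_fin dL) lee_fin; apply/ler_addgt0Pl => e e0; rewrite addr0.
set U := enorm u; have U0 : 0 <= U := enorm_ge0 u.
have G1 : 0 < (G + 1) * (U ^+ 2 + U + 1).
  by rewrite mulr_gt0// ltr_wpDl// addr_ge0// sqr_ge0.
pose e' := e / ((G + 1) * (U ^+ 2 + U + 1)).
have e'0 : 0 < e' by rewrite divr_gt0.
have [s0 s00 hs] := near0_line u (D'taylor e' e'0).
have [s1 s10 hs1] := near0_line u (enorm_near0 (n := d) ltr01).
pose s := Num.min (Num.min s0 s1) e'.
have sp : 0 < s by rewrite !lt_min s00 s10.
have ss0 : s <= s0 by rewrite !ge_min lexx.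
have ss1 : s <= s1 by rewrite !ge_min lexx orbT.
have se' : s <= e' by rewrite !ge_min lexx orbT.
have h1 := hs s; rewrite sp ss0 in h1; have {}h1 := h1 isT.
have [_ _ _ h2] := uD z (s *: u).
have := hs1 s; rewrite sp ss1 => /(_ isT)/h2 {}h2.
rewrite enormZ gtr0_norm// -/U in h1 h2.
have D'0 : {ae m, forall y, D' z 0 y = 0}.
  have := D'lin 1 0 0; apply: filterS => y; rewrite scaler0 addr0 mul1r.
  by move=> /eqP; rewrite -subr_eq subrr => /eqP <-.
have Ds y : D z (s *: u) y = s * D z u y.
  have D0 : D z 0 y = 0.
    by have := D_lin z (- 1) 0 0 y; rewrite scaler0 addr0 mulN1r addNr.
  by rewrite -[s *: u]addr0 D_lin D0 addr0.
have : (L1norm m (fun y => (s * (D' z u y - D z u y))%R) <=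
    (e' * (s * U))%:E + (G * (s * U) ^+ 2)%:E)%E.
  apply: le_trans (leeD h1 h2); rewrite addeC; apply: L1norm_leD.
  - by apply: measurable_funM => //; exact: Lfun1_measurable dL.
  - by apply: measurable_funB => //; exact: measurable_funB.
  - by apply: measurable_funB => //; exact: measurable_funB.
  apply: filterS2 D'0 (D'lin s u 0) => y D'0y; rewrite addr0 D'0y addr0 => D's.
  rewrite (_ : s * _ = (kern (z + s *: u) y - kern z y - D z (s *: u) y) -
    (kern (z + s *: u) y - kern z y - D' z (s *: u) y)); first exact: ler_normB.
  by rewrite D's Ds; ring.
rewrite L1normZ; last exact: Lfun1_measurable dL.
rewrite (Lfun1_fin dL) gtr0_norm// -EFinM -EFinD lee_fin.
rewrite (_ : _ + _ = s * (e' * U + G * s * U ^+ 2)); last by ring.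
rewrite ler_pM2l// => /le_trans; apply.
have -> : e = e' * ((G + 1) * (U ^+ 2 + U + 1)) by rewrite divfK// gt_eqF.
have GU : 0 <= G * U ^+ 2 by rewrite mulr_ge0// sqr_ge0.
apply: (@le_trans _ _ (e' * U + e' * (G * U ^+ 2))).
  by rewrite lerD2l mulrAC [leRHS]mulrC ler_wpM2l.
rewrite -mulrDr ler_pM2l//; have := sqr_ge0 U; have := mulr_ge0 G0 U0; nra.
Qed.

End derivative.

(** * Minorization of the reflected kernel *)

Lemma ae_ge_of_integral d (T : measurableType d) (R : realType)
    (m : {measure set T -> \bar R}) (f : T -> R) (delta : R) :
  (m setT < +oo)%E -> f \in Lfun m 1%E ->
  (forall B, measurable B -> delta%:E * m B <= \int[m]_(y in B) (f y)%:E)%E ->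
  {ae m, forall y, delta <= f y}.
Proof.
move=> mT fL low; have mf := Lfun1_measurable fL.
pose B := [set y | f y < delta].
have mB : measurable B.
  rewrite (_ : B = f @^-1` `]-oo, delta[); last first.
    by apply/seteqP; split => y /=; rewrite in_itv.
  by rewrite -[X in measurable X]setTI; exact: mf.
have cL : (fun=> delta) \in Lfun m 1%E.
  apply/Lfun1P; split => //; rewrite L1normE integral_cst//.
  by rewrite lte_mul_pinfty// lee_fin.
pose g y := delta - f y.
have gL : g \in Lfun m 1%E by exact: Lfun1B.
have mBfin : m B \is a fin_num.
  by rewrite ge0_fin_numE// (le_lt_trans _ mT)// le_measure// inE.
have : (\int[m]_(y in B) `|(g y)%:E| = 0)%E.
  apply/eqP; rewrite eq_le integral_ge0// andbT.
  rewrite (eq_integral (EFin \o g)); last first.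
    by move=> y; rewrite inE => By /=; rewrite ger0_norm// subr_ge0 ltW.
  have := integrable_fin_num mB (Lfun1_integrableS mB gL).
  move=> /fineK <-; rewrite lee_fin -/(Rintegral m B g).
  rewrite RintegralB//; [|exact: Lfun1_integrableS..].
  rewrite Rintegral_cst// subr_le0 -lee_fin EFinM fineK//.
  rewrite /Rintegral fineK; first exact: low.
  exact: integrable_fin_num (Lfun1_integrableS mB fL).
move=> /(ae_eq_integral_abs m mB (measurable_funS measurableT (@subsetT _ _)
  ((measurable_EFinP _ _).2 (Lfun1_measurable gL)))).
apply: filterS => y hy; rewrite leNgt; apply/negP => fy.
by have := hy fy => -[] /eqP; rewrite subr_eq0 => /eqP dy; rewrite dy ltxx in fy.
Qed.

Section minorization.
Context {R : realType} {d : nat}.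
Variables (a b h : R) (Sigma : 'M[R]_d).
Hypothesis ab : a < b.
Local Notation V := 'cV[R]_d.
Local Notation lam := (@lebesgue_cV R d).
Local Notation m := (cube_measure a b d).
Local Notation q := (noise_density h Sigma).

Lemma cube_bound (x : V) : cube a b x -> enorm x <= d%:R * (`|a| + `|b|).
Proof.
move=> xab; apply: le_trans (enorm_le_sum x) _.
apply: (@le_trans _ _ (\sum_(i < d) (`|a| + `|b|))); last first.
  by rewrite sumr_const card_ord -[_ *+ d]mulr_natl.
apply: ler_sum => i _; have /andP[ax xb] := xab i.
rewrite ler_norml; have := ler_norm b; have := ler_norm (- a); rewrite normrN.
have := normr_ge0 a; have := normr_ge0 b; lra.
Qed.

Lemma ae_cube : {ae m, forall x : V, cube a b x}.
Proof.
exists (~` cube a b); split => //.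
  by apply: measurableC; exact: measurable_cube.
by rewrite /cube_measure/= /mscale/= /mrestr setICl measure0 mule0.
Qed.

Lemma cube_measureE B : measurable B ->
  (m B = (`|b - a| ^- d)%:E * lam (B `&` cube a b))%E.
Proof. by []. Qed.

Lemma cube_measure_setT : m setT = 1%E.
Proof.
rewrite cube_measureE// setTI.
have mcube := @measurable_cube R a b d.
rewrite -[cube a b]setIT -integral_indic// .
pose f : R -> R := \1_`[a, b].
have mf : measurable_fun setT f by exact: measurable_indic.
rewrite (eq_integral (fun x : V => (\prod_(i < d) f (x i ord0))%:E)); last first.
  move=> x _; congr EFin; rewrite /f indicE.
  have [xc|xc] := pselect (cube a b x).
    rewrite mem_set// big1// => i _; rewrite indicE mem_set//=.
    by rewrite in_itv/=; exact: xc.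
  rewrite memNset//; apply/esym/eqP; rewrite prodf_seq_eq0.
  have /existsNP[i xi] := xc.
  apply/hasP; exists i; first exact: mem_index_enum.
  by rewrite /= indicE memNset//= in_itv.
rewrite (lebesgue_cV_prod d mf); last by move=> t; rewrite /f indicE.
rewrite integral_indic//= setIT lebesgue_measure_itv/= lte_fin ab -EFinB -EFin_expe.
rewrite -EFinM gtr0_norm ?subr_gt0// mulVf// gt_eqF// exprn_gt0// subr_gt0//.
Qed.

Hypothesis q1 : L1norm lam q = 1%E.

(** A Gaussian density that integrates to 1 has a nonzero normalization, so it
    is bounded away from 0 on bounded sets. *)
Lemma noise_lower_bound (rho : R) : exists2 delta : R, 0 < delta &
  forall z x, enorm z <= rho -> cube a b x -> delta <= q (x - z).
Proof.
pose C := h *: (Sigma *m Sigma^T); pose Z := Num.sqrt ((2 * pi) ^+ d * \det C).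
have Z0 : 0 < Z.
  rewrite lt_def sqrtr_ge0 andbT; apply/eqP => Z0; move: q1.
  rewrite (@L1norm_eq _ _ _ _ _ (fun=> 0)) ?L1norm0; last first.
    by move=> x; rewrite /noise_density /gaussian_density -/C -/Z Z0 invr0 mulr0.
  by move=> /eqP; rewrite eq_sym onee_eq0.
pose r := d%:R * (`|a| + `|b|) + rho; pose S := entry_sum (invmx C).
exists (expR (- (S * r ^+ 2) / 2) / Z) => [|z x zr xc]; first by rewrite divr_gt0// expR_gt0.
rewrite /noise_density /gaussian_density -/C -/Z ler_wpM2r ?invr_ge0 ?(ltW Z0)//.
rewrite ler_expR ler_wpM2r ?invr_ge0// lerN2.
have xr : enorm (x - z) <= r.
  by apply: le_trans (ler_enormD _ _) _; rewrite enormN lerD// cube_bound.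
apply: le_trans (ler_norm _) _; apply: le_trans (normr_dot_mulmx _ _ _) _.
rewrite -expr2 ler_wpM2l ?entry_sum_ge0//.
by rewrite ler_pXn2r// nnegrE ?enorm_ge0// (le_trans _ xr)// enorm_ge0.
Qed.

Variables (c : R) (kern : V -> V -> R).
Hypothesis c0 : 0 < c.
Hypothesis covc : forall x : V, c * enorm x ^+ 2 <= dot ((h *: (Sigma *m Sigma^T)) *m x) x.
Hypothesis hkern : is_reflected_kernel a b h Sigma kern.

(** The cube is fixed by folding, so the reflected density dominates the
    unreflected one there. *)
Lemma kern_lower_bound (rho : R) : exists2 delta : R, 0 < delta <= 1 / 2 &
  forall z, enorm z <= rho -> {ae m, forall y, delta <= kern z y}.
Proof.
have [de de0 hde] := noise_lower_bound rho.
have ba : 0 < `|b - a| ^+ d by rewrite exprn_gt0// normr_gt0 subr_eq0 gt_eqF.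
pose delta := Num.min (de * `|b - a| ^+ d) (1 / 2).
have delta0 : 0 < delta by rewrite lt_min mulr_gt0//=.
exists delta => [|z zr]; first by rewrite delta0 ge_min lexx orbT.
have [mk [] ] := (hkern.1, hkern.2 z); move=> mkz k0 kd.
have mq : measurable_fun setT (fun x : V => q (x - z)).
  apply: measurable_translate; exact: measurable_gaussian_density.
have mass B : measurable B -> (delta%:E * m B <= \int[m]_(y in B) (kern z y)%:E)%E.
  move=> mB; rewrite -kd// /pushforward /noise_measure.
  have mcube := @measurable_cube R a b d.
  apply: (@le_trans _ _ (\int[lam]_(x in B `&` cube a b) (q (x - z))%:E)%E); last first.
    apply: ge0_subset_integral => //.
    - exact: measurableI.
    - rewrite -[X in measurable X]setTI; exact: measurable_folding_cV.
    - by apply/measurable_EFinP; exact: measurable_funS mq.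
    - by move=> x _; rewrite lee_fin gaussian_density_ge0.
    - by move=> x [Bx xc] /=; rewrite folding_cV_id.
  apply: (@le_trans _ _ (\int[lam]_(x in B `&` cube a b) de%:E)%E); last first.
    apply: ge0_le_integral => //.
    - exact: measurableI.
    - by move=> x _; rewrite lee_fin ltW.
    - by apply/measurable_EFinP; exact: measurable_funS mq.
    - by move=> x [_ xc]; rewrite lee_fin hde.
  rewrite integral_cst//; last exact: measurableI.
  rewrite cube_measureE// muleA -EFinM lee_wpmul2r// lee_fin.
  by rewrite ler_pdivrMr// ge_min lexx.
apply: ae_ge_of_integral mass; first by rewrite cube_measure_setT ltry.
exact (kern_Lfun1 c0 covc hkern z).
Qed.

End minorization.

(** * Measurability of Lipschitz maps *)

Section lipschitz.
Context {R : realType} {n : nat}.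
Local Notation V := 'cV[R]_n.

Lemma rat_cV_dense (x : V) (e : R) : 0 < e ->
  exists v : 'cV[rat]_n, enorm (x - map_mx ratr v) <= e.
Proof.
move=> e0; have n0 : (0 : R) < n.+1%:R by rewrite ltr0n.
pose r := e / n.+1%:R; have r0 : 0 < r by rewrite divr_gt0.
have /choice[v hv] : forall i : 'I_n, exists q : rat, ratr q \in `]x i ord0 - r, x i ord0 + r[.
  by move=> i; apply: rat_in_itvoo; rewrite ltrD2l; lra.
exists (\col_i v i); apply: le_trans (enorm_le_sum _) _.
apply: (@le_trans _ _ (\sum_(i < n) r)).
  apply: ler_sum => i _; rewrite !mxE; have := hv i; rewrite in_itv/= => /andP[h1 h2].
  by rewrite ler_norml; lra.
rewrite sumr_const card_ord -[_ *+ n]mulr_natr /r mulrAC ler_pdivrMr//.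
by rewrite ler_pM2l// ler_nat.
Qed.

(** A Lipschitz function is the supremum of the countably many cones
    f v - C |x - v| with v rational. *)
Lemma measurable_lipschitz (f : V -> R) (C : R) : 0 < C ->
  (forall x y, `|f x - f y| <= C * enorm (x - y)) -> measurable_fun setT f.
Proof.
move=> C0 fC.
pose g (k : nat) (x : V) : \bar R := if (unpickle k : option 'cV[rat]_n) is Some v
  then (f (map_mx ratr v) - C * enorm (x - map_mx ratr v))%:E else -oo%E.
have mg k : measurable_fun setT (g k).
  rewrite /g; case: unpickle => [v|]; last exact: measurable_cst.
  apply/measurable_EFinP; apply: measurable_funB => //; apply: measurable_funM => //.
  apply: (measurableT_comp (continuous_measurable_fun (@sqrt_continuous R))).
  by apply: measurable_dot; exact: measurable_cVB.
apply/measurable_EFinP; rewrite (_ : EFin \o f = fun x => esups (g ^~ x) 0%N).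
  exact: measurable_fun_esups.
apply/funext => x; rewrite /esups/=; apply/eqP; rewrite eq_le; apply/andP; split.
- apply/lee_addgt0Pr => e e0.
  have [v hv] := rat_cV_dense x (divr_gt0 e0 (mulr_gt0 (ltr0Sn R 1) C0)).
  apply: (@le_trans _ _ ((f (map_mx ratr v) - C * enorm (x - map_mx ratr v)) + e)%:E).
    rewrite lee_fin; have := fC x (map_mx ratr v); rewrite ler_norml => /andP[_ h].
    have : C * enorm (x - map_mx ratr v) <= e / 2.
      apply: le_trans (ler_wpM2l (ltW C0) hv) _.
      by rewrite le_eqVlt; apply/orP; left; apply/eqP; field; rewrite gt_eqF.
    by lra.
  rewrite EFinD leeD2r//; apply: ereal_sup_ubound; exists (pickle v) => //.
  by rewrite /g pickleK.
- apply: ge_ereal_sup => _ [k _ <-]; rewrite /g; case: unpickle => [v|]; last exact: leNye.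
  rewrite lee_fin; have := fC (map_mx ratr v) x; rewrite ler_norml => /andP[_].
  by rewrite -[enorm (_ - x)]enormN opprB; lra.
Qed.

Lemma measurable_lipschitz_cV (f : V -> V) (C : R) : 0 < C ->
  (forall x y, enorm (f x - f y) <= C * enorm (x - y)) -> measurable_fun setT f.
Proof.
move=> C0 fC; apply: measurable_cVP => i; apply: (measurable_lipschitz C0) => x y.
by apply: le_trans (fC x y); have := ler_coord_enorm (f x - f y) i; rewrite !mxE.
Qed.

End lipschitz.

(** * Linear response of a family of Markov operators *)

Section linear_response.
Context d {T : measurableType d} {R : realType}.
Variable m : {sigma_finite_measure set T -> \bar R}.
Local Notation L1 := (Lfun m 1%E).
Local Notation N1 := (L1norm m).
Variables (K : R -> int -> T -> T -> R) (D : int -> T -> T -> R) (theta C : R).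
Hypothesis theta01 : 0 <= theta < 1.
Hypothesis C0 : 0 <= C.
Local Notation L := (fun k => intop m (K 0 k)).
Hypothesis cL : contracting_family m L theta.
Hypothesis kD : forall k, L1_kernel m (D k) C.
Hypothesis D0 : forall k, {ae m, forall x, \int[m]_y D k x y = 0}.

Variable mu : R -> int -> T -> R.
Local Notation g := (fun k => intop m (D k) (mu 0 k)).

Lemma intop_derivative_mean0 k phi : phi \in L1 -> L1_mean0 m (intop m (D k) phi).
Proof.
move=> phiL; split; first exact (Lfun1_intop (kD k) phiL).
by rewrite (mean_intop (kD k) phiL (D0 k)) mul0r.
Qed.

Lemma intop_derivative_bound k phi : phi \in L1 -> N1 phi = 1%E ->
  (N1 (intop m (D k) phi) <= C%:E)%E.
Proof.
by move=> phiL phi1; apply: le_trans (L1norm_intop (kD k) phiL) _; rewrite phi1 mule1.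
Qed.

Section fixed_parameter.
Variables (e w : R).
Hypothesis e0 : 0 < e.
Hypothesis kK : forall k, L1_kernel m (K e k) 1.
Hypothesis kK0 : forall k, L1_kernel m (K 0 k) 1.
Hypothesis approx : forall k,
  L1_kernel m (fun x y => e^-1 * (K e k x y - K 0 k x y) - D k x y) w.
Hypothesis muL : forall s k, s = 0 \/ s = e ->
  [/\ mu s k \in L1, N1 (mu s k) = 1%E & \int[m]_x mu s k x = 1].
Hypothesis muE : forall s k, s = 0 \/ s = e ->
  {ae m, forall y, mu s (k + 1) y = intop m (K s k) (mu s k) y}.

Let mu0L k : mu 0 k \in L1. Proof. by case: (@muL 0 k) => //; left. Qed.
Let mueL k : mu e k \in L1. Proof. by case: (@muL e k) => //; right. Qed.

Let u k x := e^-1 * (mu e k x - mu 0 k x).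

Let u0 k : L1_mean0 m (u k).
Proof.
apply: L1_mean0Z; split; first exact: Lfun1B.
have [_ _ i0] := @muL 0 k (or_introl erefl); have [_ _ ie] := @muL e k (or_intror erefl).
by rewrite Lfun1_meanB// i0 ie subrr.
Qed.

Let dK k x y := e^-1 * (K e k x y - K 0 k x y).

Let kdK k : L1_kernel m (dK k) (w + C).
Proof.
split.
  apply: measurable_funM => //.
  by apply: measurable_funB; [case: (kK k)|case: (kK0 k)].
case: (approx k) (kD k) => _ h1 [_ h2]; apply: filterS2 h1 h2 => x h1 h2.
rewrite EFinD; apply: le_trans (leeD h1 h2).
have mk := L1_kernel_section x (kK k); have mk0 := L1_kernel_section x (kK0 k).
have mD := L1_kernel_section x (kD k).
have mdK : measurable_fun setT (dK k x).
  by apply: measurable_funM => //; exact: measurable_funB.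
apply: L1norm_leD => //; first exact: measurable_funB.
apply: aeW => y; rewrite -{1}[dK k x y](subrK (D k x y)); exact: ler_normD.
Qed.

Let recursion_u k :
  {ae m, forall y, u (k + 1) y = L k (u k) y + intop m (dK k) (mu e k) y}.
Proof.
have k1 : L1_kernel m (fun x y => K e k x y - K 0 k x y) (1 + 1).
  exact: L1_kernelB (kK k) (kK0 k).
have uE := intopP (kK0 k) (- e^-1) (mu0L k) (Lfun1Z e^-1 (mueL k)).
have ueE := intopP (kK0 k) e^-1 (mueL k) (Lfun1_0 m).
have z0 := intopP (kK0 k) (- 1) (Lfun1_0 m) (Lfun1_0 m).
have h1 := muE k (or_introl erefl); have h2 := muE k (or_intror erefl).
have h3 : {ae m, forall y, intop m (dK k) (mu e k) y =
    e^-1 * intop m (fun x y => K e k x y - K 0 k x y) (mu e k) y}.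
  exact: intop_kernelZ k1 (mueL k).
have h4 := intop_kernelB (kK k) (kK0 k) (mueL k).
apply: filterS2 (filterI (filterI h1 h2) (filterI h3 h4))
  (filterI uE (filterI ueE z0)) => y [[F1 F2] [F3 F4]] [E1 [E2 E3]].
rewrite {1}/u F1 F2 F3 F4.
have -> : u k = fun x => - e^-1 * mu 0 k x + e^-1 * mu e k x.
  by apply/funext => x; rewrite /u; ring.
rewrite E1; move: E2; rewrite (_ : (fun x => _ + 0) = fun x => e^-1 * mu e k x);
  last by apply/funext => x; rewrite addr0.
move=> ->; move: E3; rewrite (_ : (fun x => _ + 0) = fun=> 0);
  last by apply/funext => x; rewrite mulr0 addr0.
move=> E3; have -> : intop m (K 0 k) (fun=> 0) y = 0 by lra.
by ring.
Qed.

Let u_bound k : (N1 (u k) <= ((w + C) / (1 - theta))%:E)%E.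
Proof.
apply: (driven_recursion_bound theta01 cL (b := e^-1 * 2) u0 _ _ _ recursion_u) => {}k.
- rewrite /u L1normZ; last by apply: Lfun1_measurable; exact: Lfun1B.
  rewrite ger0_norm ?invr_ge0 ?(ltW e0)// EFinM lee_wpmul2l// ?lee_fin ?invr_ge0 ?(ltW e0)//.
  apply: le_trans (L1normB m (Lfun1_measurable (mueL k)) (Lfun1_measurable (mu0L k))) _.
  have [_ -> _] := @muL 0 k (or_introl erefl); have [_ -> _] := @muL e k (or_intror erefl).
  by rewrite -EFinD lee_fin.
- exact (measurable_intop (kdK k) (mueL k)).
- apply: le_trans (L1norm_intop (kdK k) (mueL k)) _.
  by have [_ -> _] := @muL e k (or_intror erefl); rewrite mule1.
Qed.

(** The difference between the quotient u and the response is again a solution,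
    with a forcing term made of the approximation error of the kernel and of the
    displacement of the density; the displacement is e u, and u is bounded. *)
Lemma response_approximation k :
  (N1 (fun x => (mu e k x - mu 0 k x) / e - response L g k x)%R
   <= ((w + C * (e * ((w + C) / (1 - theta)))) / (1 - theta))%:E)%E.
Proof.
have t0 : 0 < 1 - theta by rewrite subr_gt0; case/andP: theta01.
have g0 j : L1_mean0 m (g j) by exact: intop_derivative_mean0.
have gC j : (N1 (g j) <= C%:E)%E.
  apply: intop_derivative_bound => //.
  by have [_ -> _] := @muL 0 j (or_introl erefl).
pose v j x := u j x - response L g j x.
have v0 j : L1_mean0 m (v j).
  apply: L1_mean0B => //; exact: (response_mean0 theta01 cL g0 gC).
rewrite (@L1norm_eq _ _ _ _ _ (v k)); last first.
  by move=> x; rewrite /v /u mulrC.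
pose r j := fun x => intop m (fun x y => dK j x y - D j x y) (mu e j) x +
   intop m (D j) (fun x => mu e j x - mu 0 j x) x.
have dL j : (fun x => mu e j x - mu 0 j x) \in L1 by exact: Lfun1B.
have mr j : measurable_fun setT (r j).
  apply: measurable_funD; first exact (measurable_intop (approx j) (mueL j)).
  exact (measurable_intop (kD j) (dL j)).
apply: (driven_recursion_bound theta01 cL
  (b := (w + C) / (1 - theta) + C / (1 - theta)) v0 _ mr) => {}k.
- have uL := (u0 k).1.
  have rL := (response_mean0 theta01 cL g0 gC k).1.
  apply: le_trans (L1normB m (Lfun1_measurable uL) (Lfun1_measurable rL)) _.
  rewrite EFinD; apply: leeD (u_bound k) _.
  exact: (response_bound theta01 cL g0 gC).
- rewrite EFinD; apply: le_trans (L1normD m _ _) _.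
  + exact (measurable_intop (approx k) (mueL k)).
  + exact (measurable_intop (kD k) (dL k)).
  apply: leeD.
    apply: le_trans (L1norm_intop (approx k) (mueL k)) _.
    by have [_ -> _] := @muL e k (or_intror erefl); rewrite mule1.
  apply: le_trans (L1norm_intop (kD k) (dL k)) _.
  rewrite EFinM lee_wpmul2l// ?lee_fin//.
  rewrite (@L1norm_eq _ _ _ _ _ (fun x => e * u k x)); last first.
    by move=> x; rewrite /u mulrA mulfV ?gt_eqF// mul1r.
  rewrite L1normZ; last by have [/Lfun1_measurable] := u0 k.
  by rewrite ger0_norm ?(ltW e0)// EFinM lee_wpmul2l// lee_fin ltW.
have lin := contracting_familyB cL k (u0 k).1 (response_mean0 theta01 cL g0 gC k).1.
have rr := response_recursion theta01 cL g0 gC k.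
have h1 := intop_kernelB (kdK k) (kD k) (mueL k).
have h2 := intopP (kD k) (- 1) (mu0L k) (mueL k).
apply: filterS2 (filterI lin rr) (filterI (recursion_u k) (filterI h1 h2)).
move=> y [E1 E2] [E3 [E4 E5]]; rewrite /v E2 E3 {}E1 /r E4.
rewrite (_ : (fun x => mu e k x - mu 0 k x) = (fun x => - 1 * mu 0 k x + mu e k x)).
  by rewrite E5; ring.
by apply/funext => x; rewrite mulN1r addrC.
Qed.

End fixed_parameter.
End linear_response.

(** * The reflected Euler-Maruyama chain *)

Section ereal_limits.
Context {R : realType} {T : Type}.

Lemma ereal_cvg0 (F : set_system T) {FF : Filter F} (f : T -> \bar R) :
  (forall x, (0 <= f x)%E) ->
  (forall e : R, 0 < e -> \forall x \near F, (f x <= e%:E)%E) -> f @ F --> 0%E.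
Proof.
move=> f0 fe; apply/fine_cvgP; split.
  apply: filterS (fe 1 ltr01) => x fx; rewrite ge0_fin_numE//.
  by apply: le_lt_trans fx _; rewrite ltry.
apply/cvgrPdist_le => e e0; apply: filterS (fe e e0) => x fx /=.
rewrite sub0r normrN ger0_norm ?fine_ge0// -lee_fin fineK//.
by rewrite ge0_fin_numE// (le_lt_trans fx)// ltry.
Qed.

End ereal_limits.

Lemma geometric_near0 (R : realType) (c q e : R) : 0 <= q < 1 -> 0 < e ->
  \forall n \near \oo, c * q ^+ n <= e.
Proof.
move=> /andP[q0 q1] e0.
have cvg : (c * q ^+ n) @[n --> \oo] --> c * 0.
  by apply: cvgM; [exact: cvg_cst|apply: cvg_expr; rewrite ger0_norm].
rewrite mulr0 in cvg.
have /cvgrPdist_le/(_ e e0) := cvg; apply: filterS => n /=.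
by rewrite sub0r normrN; apply: le_trans; exact: ler_norm.
Qed.

Section linfL1norm_lemmas.
Context d {T : measurableType d} {R : realType} (m : {measure set T -> \bar R}).
Implicit Types u : int -> T -> R.

Lemma linfL1norm_ge0 u : (0 <= linfL1norm m u)%E.
Proof. by apply: le_trans (L1norm_ge0 m (u 0)) _; apply: ereal_sup_ubound; exists 0. Qed.

Lemma linfL1norm_le u (c : \bar R) : (forall k, (L1norm m (u k) <= c)%E) ->
  (linfL1norm m u <= c)%E.
Proof. by move=> uc; apply: ge_ereal_sup => _ [k _ <-]. Qed.

Lemma probability_density_Lfun1 (f : T -> R) : is_probability_density m f ->
  [/\ f \in Lfun m 1%E, L1norm m f = 1%E & \int[m]_x f x = 1].
Proof.
move=> [mf f0 f1]; have n1 : L1norm m f = 1%E.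
  rewrite -f1 L1normE; apply: ae_eq_integral => //.
  - exact: measurable_normE.
  - exact/measurable_EFinP.
  - by apply: filterS f0 => x f0 _; rewrite ger0_norm.
by split => //; [apply/Lfun1P; rewrite n1 ltry|rewrite /Rintegral f1].
Qed.

End linfL1norm_lemmas.

Section cube_space.
Context {R : realType} {d : nat}.
Variables (a b : R).
Hypothesis ab : a < b.
Local Notation m := (cube_measure a b d).

Lemma cube_measure_sigma_finite : sigma_finite setT m.
Proof.
apply: fin_num_fun_sigma_finite; first by rewrite measure0 ltry.
move=> A mA; rewrite ge0_fin_numE//; apply: (@le_lt_trans _ _ (m setT)).
  by apply: le_measure; rewrite ?inE.
by rewrite cube_measure_setT// ltry.
Qed.

(** The measure of cube_measure, bundled with the sigma-finiteness that Fubini's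
    theorem asks for. *)
Definition cube_sigma_finite : {sigma_finite_measure set 'cV[R]_d -> \bar R} :=
  HB.pack_for (SigmaFiniteMeasure.type 'cV[R]_d R) (Measure.sort m)
    (Measure_isSigmaFinite.Build _ _ _ (Measure.sort m) cube_measure_sigma_finite).

End cube_space.

Section chain.
Context {R : realType} {d : nat}.
Variables (a b t0 h eps0 : R).
Hypothesis ab : a < b.
Hypothesis h0 : 0 < h.
Hypothesis eps00 : 0 < eps0.
Variables (beta : R -> R -> 'cV[R]_d -> 'cV[R]_d) (Sigma : 'M[R]_d) (lm L B : R).
Hypothesis lm0 : 0 < lm.
Hypothesis L0 : 0 < L.
Hypothesis covA : forall xi : 'cV[R]_d,
  lm * enorm xi ^+ 2 <= dot ((Sigma *m Sigma^T) *m xi) xi.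
Hypothesis beta_lip : forall e t x y, 0 <= e < eps0 ->
  enorm (beta e t x - beta e t y) <= L * enorm (x - y).
Hypothesis beta0 : forall e t, 0 <= e < eps0 -> enorm (beta e t 0) <= B.
Variable kern : 'cV[R]_d -> 'cV[R]_d -> R.
Hypothesis hkern : is_reflected_kernel a b h Sigma kern.

Local Notation V := 'cV[R]_d.
Local Notation lam := (@lebesgue_cV R d).
Local Notation m := (cube_sigma_finite ab : {sigma_finite_measure set V -> \bar R}).
Local Notation q := (noise_density h Sigma).
Local Notation t := (fun k : int => t0 + k%:~R * h).
Local Notation F := (fun e => euler_map h (beta e) t).
Local Notation K := (fun e k x y => kern (F e k x) y).

Let ae_m_cube : {ae (m : {measure set V -> \bar R}), forall x : V, cube a b x}.
Proof. exact (ae_cube a b). Qed.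

Lemma noise_covariance_bound (x : V) :
  h * lm * enorm x ^+ 2 <= dot ((h *: (Sigma *m Sigma^T)) *m x) x.
Proof. by rewrite -scalemxAl dotZl -mulrA ler_pM2l. Qed.

Let hlm : 0 < h * lm. Proof. exact: mulr_gt0. Qed.
Let covc := noise_covariance_bound.

Definition cube_radius : R := d%:R * (`|a| + `|b|).

Lemma cube_radius_ge0 : 0 <= cube_radius.
Proof. by rewrite mulr_ge0 ?ler0n// addr_ge0. Qed.

Definition chain_radius : R := cube_radius + h * (B + L * cube_radius).

Lemma euler_map_bound e k (x : V) : 0 <= e < eps0 -> cube a b x ->
  enorm (F e k x) <= chain_radius.
Proof.
move=> he /cube_bound; rewrite -/cube_radius => xr.
apply: le_trans (ler_enormD _ _) _; rewrite lerD//.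
rewrite enormZ gtr0_norm// ler_pM2l// -(subrK (beta e (t k) 0) (beta e (t k) x)).
apply: le_trans (ler_enormD _ _) _; rewrite addrC lerD//; first exact: beta0.
apply: le_trans (beta_lip _ _ _ he) _; rewrite subr0 ler_pM2l//.
Qed.

Lemma measurable_euler_map e k : 0 <= e < eps0 -> measurable_fun setT (F e k).
Proof.
move=> he; apply: measurable_cVD => //; apply: measurable_cVZ => //.
by apply: (measurable_lipschitz_cV L0) => x y; exact: beta_lip.
Qed.

Lemma measurable_chain_kernel e k : 0 <= e < eps0 ->
  measurable_fun setT (fun p : V * V => K e k p.1 p.2).
Proof.
move=> he; apply: (measurable_kern2 hkern) => //.
by apply: (measurableT_comp (measurable_euler_map k he)).
Qed.

Lemma chain_kernel_L1 e k : 0 <= e < eps0 ->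
  L1_kernel m (K e k) (fine (L1norm lam q)).
Proof.
move=> he; split; first exact: measurable_chain_kernel.
apply: aeW => x; rewrite -Lfun1_fin; last exact: noise_density_Lfun1 hlm covc.
by rewrite (kern_L1norm hlm covc hkern).
Qed.

Variable mu : R -> int -> V -> R.
Hypothesis mu_equivariant : forall e, 0 <= e < eps0 ->
  equivariant a b (transfer a b kern (F e)) (mu e).

Let e00 : 0 <= (0 : R) < eps0. Proof. by rewrite lexx. Qed.

(** The operators multiply the integral by the mass of the Gaussian density,
    and an equivariant family of probability densities leaves no choice for the
    latter. *)
Lemma noise_density_mass : L1norm lam q = 1%E.
Proof.
rewrite (Lfun1_fin (noise_density_Lfun1 hlm covc)); congr EFin.
have [dens rec] := mu_equivariant e00.
have [L0' _ i0] := probability_density_Lfun1 (dens 0).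
have [L1' _ i1] := probability_density_Lfun1 (dens (0 + 1)).
have k0 := chain_kernel_L1 0 e00.
have := mean_intop k0 (c := fine (L1norm lam q)) L0'.
rewrite i0 mulr1 => <-; last by apply: aeW => x; exact: (kern_mean hlm covc hkern).
rewrite -i1; apply: ae_eq_Rintegral.
- exact (measurable_intop k0 L0').
- exact: Lfun1_measurable L1'.
- by apply: filterS (rec 0) => y ->.
Qed.

Let mass1 : fine (L1norm lam q) = 1. Proof. by rewrite noise_density_mass. Qed.

Lemma chain_kernel_stochastic e k : 0 <= e < eps0 -> L1_kernel m (K e k) 1.
Proof. by move=> he; have := chain_kernel_L1 k he; rewrite mass1. Qed.

(** Points of the cube are moved by a bounded amount, uniformly in time, so the
    minorization constant of the kernel is uniform in time as well. *)
Lemma chain_contracting : exists2 theta : R, 0 <= theta < 1 &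
  contracting_family m (fun k => intop m (K 0 k)) theta.
Proof.
have [de /andP[de0 de1] hde] := kern_lower_bound ab noise_density_mass hlm covc hkern chain_radius.
exists (1 - de); first by lra.
have kK k := chain_kernel_stochastic k e00.
have mT : (m : set V -> \bar R) setT = 1%E by exact: cube_measure_setT.
split.
- move=> k f [fL f0]; split; first exact (Lfun1_intop (kK k) fL).
  rewrite (mean_intop (kK k) (c := 1) fL) ?f0 ?mulr0//.
  by apply: aeW => x; rewrite (kern_mean hlm covc hkern) mass1.
- move=> k f [fL f0].
  have := @doeblin_contraction _ _ _ m (K 0 k) 1 de f.
  rewrite mT ltry /= mulr1; apply => //.
  + exact: measurable_chain_kernel.
  + apply: aeW => x; split; first exact (kern_Lfun1 hlm covc hkern _).
    by rewrite (kern_mean hlm covc hkern) mass1.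
  + apply: filterS ae_m_cube => x xc; apply: hde.
    exact: euler_map_bound.
  + exact: ltW.
- by move=> k c f g fL gL; exact (intopP (kK k) c fL gL).
- by move=> k f g mf mg fg; exact (intop_ae (kK k) mf mg fg).
Qed.

Variables (bdot : R -> V -> V) (r : R -> R -> V -> V).
Hypothesis mbdot : measurable_fun setT
  (fun p : measurableTypeR R * V => bdot p.1 p.2).
Hypothesis beta_expansion : forall e t x, 0 <= e < eps0 ->
  beta e t x = beta 0 t x + e *: bdot t x + r e t x.
Hypothesis bdot_bounded : forall rho : R, 0 < rho ->
  (ereal_sup [set (enorm (bdot p.1 p.2))%:E
             | p in [set p : R * V | (enorm p.2 <= rho)%R]] < +oo)%E.
Hypothesis r_small : forall rho : R, 0 < rho ->
  ereal_sup [set (enorm (r e p.1 p.2) / `|e|)%:E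
            | p in [set p : R * V | enorm p.2 <= rho]] @[e --> 0^'+] --> 0%E.

Lemma bdot_bound_on_cube : exists2 M : R, 0 <= M &
  forall t x, cube a b x -> enorm (bdot t x) <= M.
Proof.
have rho0 : 0 < cube_radius + 1 by rewrite ltr_wpDl// cube_radius_ge0.
have := bdot_bounded rho0; set s := ereal_sup _ => soo.
have le_s u x : enorm x <= cube_radius + 1 -> ((enorm (bdot u x))%:E <= s)%E.
  by move=> xr; apply: ereal_sup_ubound; exists (u, x).
have s0 : (0 <= s)%E.
  apply: le_trans (le_s 0 0 _); first by rewrite lee_fin enorm_ge0.
  by rewrite enorm0 ltW.
have sfin : s \is a fin_num by rewrite ge0_fin_numE.
exists (fine s) => [|u x /cube_bound xr]; first exact: fine_ge0.
rewrite -lee_fin fineK// le_s//; apply: le_trans xr _.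
by rewrite lerDl.
Qed.

Lemma remainder_on_cube (w : R) : 0 < w -> \forall e \near 0^'+,
  forall t x, cube a b x -> enorm (r e t x) <= e * w.
Proof.
move=> w0; have rho0 : 0 < cube_radius + 1 by rewrite ltr_wpDl// cube_radius_ge0.
have /fine_cvgP[rfin /cvgrPdist_le/(_ w w0) rw] := r_small rho0.
near=> e; move=> u x xc; have e0 : 0 < e by near: e; exact: nbhs_right_gt.
rewrite mulrC -ler_pdivrMr// -lee_fin.
apply: (@le_trans _ _ (ereal_sup [set (enorm (r e p.1 p.2) / `|e|)%:E
    | p in [set p : R * V | enorm p.2 <= cube_radius + 1]])).
  apply: ereal_sup_ubound; exists (u, x) => /=; last by rewrite gtr0_norm.
  by apply: le_trans (cube_bound xc) _; rewrite lerDl.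
have fin : ereal_sup [set (enorm (r e p.1 p.2) / `|e|)%:E
    | p in [set p : R * V | enorm p.2 <= cube_radius + 1]] \is a fin_num by near: e.
rewrite -(fineK fin) lee_fin; apply: le_trans (ler_norm _) _.
by rewrite -normrN -sub0r; near: e.
Unshelve. all: by end_near. Qed.

Local Notation Dk := (kern_derivative kern).
Local Notation D := (fun k x y => Dk (F 0 k x) (h *: bdot (t k) x) y).

Section derivative_kernels.
Variable G : R.
Hypothesis G0 : 0 <= G.
Hypothesis uD : uniform_derivative a b kern G Dk.

Lemma measurable_derivative_kernel (D' : V -> V -> V -> R) k :
  measurable_fun setT (fun p : V * V * V => D' p.1.1 p.1.2 p.2) ->
  measurable_fun setT (fun p : V * V => D' (F 0 k p.1) (h *: bdot (t k) p.1) p.2).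
Proof.
move=> mD'; have mb : measurable_fun setT (fun x : V => bdot (t k) x).
  exact: (measurableT_comp mbdot (measurable_pair1 (t k : measurableTypeR R))).
apply: (measurableT_comp mD' (measurable_fun_pair
  (f := fun p : V * V => (F 0 k p.1, h *: bdot (t k) p.1)) (g := snd) _ _)) => //.
apply: measurable_fun_pair.
  exact: (measurableT_comp (measurable_euler_map k e00)).
by apply: measurable_cVZ => //; exact: (measurableT_comp mb).
Qed.

Lemma derivative_kernel_L1 (M : R) k : 0 <= M ->
  (forall t x, cube a b x -> enorm (bdot t x) <= M) ->
  L1_kernel m (D k) (G * (h * M)).
Proof.
move=> M0 bM; split.
  exact: measurable_derivative_kernel (measurable_kern_derivative hkern).
apply: filterS ae_m_cube => x xc; have [_ _ Db _] := uD (F 0 k x) (h *: bdot (t k) x).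
apply: le_trans Db _; rewrite lee_fin ler_wpM2l// enormZ gtr0_norm// ler_pM2l//.
exact: bM.
Qed.

(** The kernels are expanded along the perturbation of the drift; the remainder
    r contributes through the bound on the derivative, and the second-order
    term of the kernel is quadratic in the whole displacement. *)
Lemma chain_kernel_expansion (M w e : R) k : 0 <= M ->
  (forall t x, cube a b x -> enorm (bdot t x) <= M) ->
  0 < e < eps0 -> 0 < w -> e * (h * (M + w)) <= 1 ->
  (forall t x, cube a b x -> enorm (r e t x) <= e * w) ->
  L1_kernel m (fun x y => e^-1 * (K e k x y - K 0 k x y) - D k x y)
    (G * (e * (h * (M + w)) ^+ 2 + h * w)).
Proof.
move=> M0 bM /andP[e0 eeps] w0 small rw.
have he : 0 <= e < eps0 by rewrite ltW.
split.
  apply: measurable_funB.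
    apply: measurable_funM => //.
    by apply: measurable_funB; exact: measurable_chain_kernel.
  exact: measurable_derivative_kernel (measurable_kern_derivative hkern).
apply: filterS ae_m_cube => x xc.
pose z := F 0 k x; pose v := h *: bdot (t k) x; pose s := h *: r e (t k) x.
pose u := e *: v + s.
have Fe : F e k x = z + u.
  rewrite /euler_map beta_expansion// /z /u /v /s /euler_map !scalerDr !scalerA.
  by rewrite [e * h]mulrC !addrA.
have sb : enorm s <= e * (h * w).
  by rewrite /s enormZ gtr0_norm// mulrCA ler_pM2l// rw.
have ub : enorm u <= e * (h * (M + w)).
  apply: le_trans (ler_enormD _ _) _.
  rewrite mulrDr mulrDr lerD// enormZ gtr0_norm// ler_pM2l// enormZ gtr0_norm// ler_pM2l//.
  exact: bM.
have u1 : enorm u <= 1 := le_trans ub small.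
have [_ _ _ taylor] := uD z u; have [mDs _ Ds _] := uD z s.
have [mDv _ _ _] := uD z v; have [mDu _ _ _] := uD z u.
have mk y : measurable_fun setT (kern y) := measurable_kern hlm covc hkern y.
apply: (@le_trans _ _ (L1norm m (fun y => (e^-1 * (kern (z + u) y - kern z y - Dk z u y))%R) +
  L1norm m (fun y => (e^-1 * Dk z s y)%R))%E).
  apply: L1norm_leD.
  - by apply: measurable_funB => //; apply: measurable_funM => //; exact: measurable_funB.
  - by apply: measurable_funM => //; apply: measurable_funB => //; exact: measurable_funB.
  - exact: measurable_funM.
  apply: aeW => y; rewrite Fe -/z -/v; apply: le_trans (ler_normD _ _).
  rewrite /u kern_derivative_linear le_eqVlt; apply/orP; left; apply/eqP; congr (`|_|).
  by field; rewrite gt_eqF.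
rewrite mulrDr EFinD; apply: leeD.
  rewrite L1normZ; last by apply: measurable_funB => //; exact: measurable_funB.
  apply: le_trans (lee_wpmul2l _ (taylor u1)) _ => //.
  rewrite -EFinM lee_fin gtr0_norm ?invr_gt0// mulrCA ler_wpM2l// mulrC ler_pdivrMr//.
  apply: le_trans (_ : (e * (h * (M + w))) ^+ 2 <= _).
    by rewrite ler_pXn2r// nnegrE ?enorm_ge0// (le_trans (enorm_ge0 u)).
  by rewrite le_eqVlt; apply/orP; left; apply/eqP; ring.
rewrite L1normZ//; apply: le_trans (lee_wpmul2l _ Ds) _ => //.
rewrite -EFinM lee_fin gtr0_norm ?invr_gt0// mulrCA ler_wpM2l// mulrC ler_pdivrMr//.
by rewrite mulrC.
Qed.

End derivative_kernels.


(** * Convergence of the difference quotients *)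

Lemma chain_difference_quotient (G M theta : R) : 0 <= G ->
  uniform_derivative a b kern G Dk -> 0 <= M ->
  (forall t x, cube a b x -> enorm (bdot t x) <= M) ->
  0 <= theta < 1 -> contracting_family m (fun k => intop m (K 0 k)) theta ->
  linfL1norm m (fun k y => (mu e k y - mu 0 k y) / e -
    response (fun k => intop m (K 0 k)) (fun k => intop m (D k) (mu 0 k)) k y)
    @[e --> 0^'+] --> 0%E.
Proof.
move=> G0 uD M0 bM theta01 cL.
apply: ereal_cvg0 => [e|eta eta0]; first exact: linfL1norm_ge0.
have t1 : 0 < 1 - theta by rewrite subr_gt0; case/andP: theta01.
pose C := G * (h * M); have C0 : 0 <= C by rewrite !mulr_ge0// ltW.
have Gh : 0 < G * h + 1 by rewrite ltr_wpDl// mulr_ge0// ltW.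
(* Half of the admissible forcing goes to the error w of the kernel expansion,
   the other half to the displacement of the densities. *)
pose w := Num.min 1 (eta * (1 - theta) / 2).
have w0 : 0 < w by rewrite lt_min ltr01 !divr_gt0// mulr_gt0.
pose w1 := w / (2 * (G * h + 1)).
have w10 : 0 < w1 by rewrite divr_gt0// mulr_gt0.
pose A := h * (M + w1); have A0 : 0 < A by rewrite mulr_gt0// ltr_wpDl.
have GA : 0 < 2 * (G * A ^+ 2 + 1).
  by rewrite mulr_gt0// ltr_wpDl// mulr_ge0// sqr_ge0.
pose U := C * ((w + C) / (1 - theta)).
have U0 : 0 <= U by rewrite mulr_ge0// divr_ge0 ?(ltW t1)// addr_ge0// ltW.
have U1 : 0 < U + 1 by rewrite ltr_wpDl.
have etaU : 0 < eta * (1 - theta) / 2 / (U + 1) by rewrite !divr_gt0// mulr_gt0.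
near=> e; have e0 : 0 < e by near: e; exact: nbhs_right_gt.
have eeps : e < eps0 by near: e; exact: nbhs_right_lt.
have eA : e * A <= 1.
  by rewrite -ler_pdivlMr// div1r; near: e; apply: nbhs_right_le; rewrite invr_gt0.
have eGA : e <= w / (2 * (G * A ^+ 2 + 1)).
  by near: e; apply: nbhs_right_le; rewrite divr_gt0.
have eU : e * (U + 1) <= eta * (1 - theta) / 2.
  by rewrite -ler_pdivlMr//; near: e; exact: nbhs_right_le.
have re : forall t x, cube a b x -> enorm (r e t x) <= e * w1.
  by near: e; exact: remainder_on_cube.
have he : 0 <= e < eps0 by rewrite ltW.
have approx k : L1_kernel m (fun x y => e^-1 * (K e k x y - K 0 k x y) - D k x y) w.
  have [mE bE] := chain_kernel_expansion G0 uD k M0 bM (introT andP (conj e0 eeps)) w10 eA re.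
  split => //; apply: filterS bE => x /le_trans; apply; rewrite lee_fin.
  have h1 : G * (h * w1) <= w / 2.
    rewrite [leLHS](_ : _ = (w / 2) * (G * h / (G * h + 1))); last first.
      by rewrite /w1; field; rewrite gt_eqF.
    by rewrite ler_piMr ?divr_ge0 ?(ltW w0)// ler_pdivrMr// mul1r lerDl.
  have h2 : G * (e * A ^+ 2) <= w / 2.
    rewrite ler_pdivlMr// in eGA.
    have := mulr_ge0 (ltW e0) (mulr_ge0 G0 (sqr_ge0 A)); nra.
  by rewrite mulrDr -/A; lra.
have muP s k : s = 0 \/ s = e ->
    [/\ mu s k \in Lfun m 1%E, L1norm m (mu s k) = 1%E & \int[m]_x mu s k x = 1].
  move=> hs; have hs' : 0 <= s < eps0 by case: hs => ->.
  by apply: probability_density_Lfun1; have [] := mu_equivariant hs'.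
have muR s k : s = 0 \/ s = e ->
    {ae (m : {measure set V -> \bar R}), forall y, mu s (k + 1) y = intop m (K s k) (mu s k) y}.
  move=> hs; have hs' : 0 <= s < eps0 by case: hs => ->.
  by have [_] := mu_equivariant hs'.
apply: linfL1norm_le => k.
have D0 j : {ae (m : {measure set V -> \bar R}), forall x, \int[m]_y D j x y = 0}.
  by apply: aeW => x; case: (uD (F 0 j x) (h *: bdot (t j) x)).
have kDk j := derivative_kernel_L1 G0 uD j M0 bM.
have := response_approximation (K := K) (D := D) theta01 C0 cL kDk D0 e0
  (fun k => chain_kernel_stochastic k he)
  (fun k => chain_kernel_stochastic k e00) approx muP muR k.
move=> /le_trans; apply.
rewrite lee_fin ler_pdivrMr//.
have -> : C * (e * ((w + C) / (1 - theta))) = e * U by rewrite /U; ring.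
have wle : w <= eta * (1 - theta) / 2 by rewrite ge_min lexx orbT.
by lra.
Unshelve. all: by end_near. Qed.

End chain.


Theorem theorem21 (R : realType) (d : nat) (hd : (0 < d)%N)
    (a b : R) (hab : a < b) (t0 h : R) (hh : 0 < h)
    (eps0 : R) (heps0 : 0 < eps0)
    (beta : R -> R -> 'cV[R]_d -> 'cV[R]_d) (Sigma : 'M[R]_d)
    (lm lp L B c0 c1 : R)
    (hlm : 0 < lm) (hlp : lm <= lp)
    (hL : 0 < L) (hB : 0 < B) (hc0 : 0 < c0) (hc1 : 0 < c1)
    (hA : forall xi : 'cV[R]_d,
      lm * enorm xi ^+ 2 <= dot ((Sigma *m Sigma^T) *m xi) xi /\
      dot ((Sigma *m Sigma^T) *m xi) xi <= lp * enorm xi ^+ 2)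
    (hLip : forall e t x y, 0 <= e < eps0 ->
      enorm (beta e t x - beta e t y) <= L * enorm (x - y))
    (hbd : forall e t, 0 <= e < eps0 -> enorm (beta e t 0) <= B)
    (hdiss : forall e t x, 0 <= e < eps0 ->
      dot (beta e t x) x <= c0 - c1 * enorm x ^+ 2)
    (bdot : R -> 'cV[R]_d -> 'cV[R]_d)
    (r : R -> R -> 'cV[R]_d -> 'cV[R]_d)
    (hbdot : measurable_fun setT
      (fun p : measurableTypeR R * 'cV[R]_d => bdot p.1 p.2))
    (hexp : forall e t x, 0 <= e < eps0 ->
      beta e t x = beta 0 t x + e *: bdot t x + r e t x)
    (hbdotb : forall rho : R, 0 < rho ->
      (ereal_sup [set (enorm (bdot p.1 p.2))%:E
                 | p in [set p : R * 'cV[R]_d | (enorm p.2 <= rho)%R]]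
        < +oo)%E)
    (hr : forall rho : R, 0 < rho ->
      ereal_sup [set (enorm (r e p.1 p.2) / `|e|)%:E
                | p in [set p : R * 'cV[R]_d | enorm p.2 <= rho]]
        @[e --> 0^'+] --> 0%E)
    (kern : 'cV[R]_d -> 'cV[R]_d -> R)
    (hkern : is_reflected_kernel a b h Sigma kern) :
  let m := cube_measure a b d in
  let t := fun k : int => t0 + k%:~R * h in
  let F := fun e => euler_map h (beta e) t in
  let Lop := fun e => transfer a b kern (F e) in
  forall (mu : R -> int -> 'cV[R]_d -> R),
  (forall e, 0 <= e < eps0 -> equivariant a b (Lop e) (mu e)) ->
  exists eta : int -> 'cV[R]_d -> R,
    [/\ (forall k, eta k \in Lfun m 1) /\ (linfL1norm m eta < +oo)%E,
        linfL1norm m (fun k y => (mu e k y - mu 0 k y) / e - eta k y)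
          @[e --> 0^'+] --> 0%E,
        exists Dk, is_kernel_derivative a b kern Dk &
        forall Dk, is_kernel_derivative a b kern Dk ->
        let Ldot := transfer_dot a b h Dk (F 0) bdot t in
        let g := fun k => Ldot k (mu 0 k) in
        let term := fun k j => cocycle (Lop 0) k j (g (k - j%:Z - 1)) in
        [/\ forall k phi, phi \in Lfun m 1 -> Ldot k phi \in Lfun m 1,
            ereal_sup (range (fun k =>
                \sum_(N <= j <oo) L1norm m (term k j))%E)
              @[N --> \oo] --> 0%E &
            linfL1norm m (fun k y => eta k y - \sum_(j < N) term k j y)
              @[N --> \oo] --> 0%E]].
Proof.
move=> m t F Lop mu mu_eq.
have covA xi : lm * enorm xi ^+ 2 <= dot ((Sigma *m Sigma^T) *m xi) xi by case: (hA xi).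
pose ms : {sigma_finite_measure set 'cV[R]_d -> \bar R} := cube_sigma_finite hab.
have hlm0 : 0 < h * lm by rewrite mulr_gt0.
have covc := noise_covariance_bound hh covA.
have e00 : 0 <= (0 : R) < eps0 by rewrite lexx.
have [G G0 uD] := kern_derivative_uniform hlm0 covc hkern.
have [M M0 bM] := bdot_bound_on_cube a b hbdotb.
have [theta theta01 cL] := chain_contracting hab hh heps0 hlm hL covA hLip hbd hkern mu_eq.
pose D k x y := kern_derivative kern (F 0 k x) (h *: bdot (t k) x) y.
pose C := G * (h * M); have C0 : 0 <= C by rewrite !mulr_ge0// ltW.
have kD k : L1_kernel ms (D k) C.
  exact (derivative_kernel_L1 t0 hab hh heps0 hL hLip hkern hbdot G0 uD k M0 bM).
have mu0P k := probability_density_Lfun1 ((mu_eq 0 e00).1 k).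
have muL k : mu 0 k \in Lfun ms 1%E by case: (mu0P k).
pose g k := intop ms (D k) (mu 0 k).
have g0 k : L1_mean0 ms (g k).
  apply: (intop_derivative_mean0 kD) => // j; apply: aeW => x.
  by case: (uD (F 0 j x) (h *: bdot (t j) x)).
have gC k : (L1norm ms (g k) <= C%:E)%E.
  by apply: (intop_derivative_bound kD) => //; case: (mu0P k).
pose eta := response (Lop 0) g.
exists eta; split.
- split=> [k|]; first by have [] := response_mean0 theta01 cL g0 gC k.
  apply: (@le_lt_trans _ _ (C / (1 - theta))%:E); last by rewrite ltry.
  by apply: linfL1norm_le => k; exact: (response_bound theta01 cL g0 gC).
- exact (chain_difference_quotient hh heps0 hlm hL covA hLip hkern mu_eq hbdot hexp hr G0 uD M0 bM theta01 cL).
- exists (kern_derivative kern); apply: (uniform_derivative_frechet G0 uD).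
    by move=> z s u v y; exact: kern_derivative_linear.
  exact: measurable_kern_derivative hkern.
move=> Dk hDk Ldot g' term.
pose D' k x y := Dk (F 0 k x) (h *: bdot (t k) x) y.
have mkern z : measurable_fun setT (kern z) := measurable_kern hlm0 covc hkern z.
(* The operators built from two derivatives of the kernel agree almost
   everywhere, and so do the terms of the two series. *)
have D'E k x : {ae m, forall y, D' k x y = D k x y}.
  apply: (kernel_derivative_unique mkern G0 uD) hDk => z s u v y.
  exact: kern_derivative_linear.
have kD' k : L1_kernel ms (D' k) C.
  have mD' : measurable_fun setT (fun p : 'cV[R]_d * 'cV[R]_d => D' k p.1 p.2).
    exact (measurable_derivative_kernel t0 h heps0 hL hLip hbdot k hDk.1).
  split => //; have [_ bD] := kD k; apply: filterS bD => x.
  rewrite (@L1norm_ae _ _ _ m (D' k x) (D k x))//; last exact (L1_kernel_section x (kD k)).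
  exact: (measurableT_comp mD' (measurable_pair1 x)).
have LdotL k phi : phi \in Lfun m 1%E -> Ldot k phi \in Lfun m 1%E.
  by move=> phiL; exact (Lfun1_intop (kD' k) phiL).
have g'E k : {ae m, forall y, g' k y = g k y}.
  by apply: (eq_intop_kernel (kD' k) (kD k) _ (muL k)); apply: aeW => x; exact: D'E.
have mg' k : measurable_fun setT (g' k) := Lfun1_measurable (LdotL k _ (muL k)).
have g'0 k : L1_mean0 m (g' k) by exact: (L1_mean0_ae (g0 k) (mg' k) (g'E k)).
have termE k j : {ae m, forall y, term k j y = response_term (Lop 0) g k j y}.
  apply: (cocycle_ae cL k j (mg' _) _ (g'E _)).
  exact: Lfun1_measurable (g0 _).1.
have term0 k j : L1_mean0 m (term k j) by exact: (cocycle_mean0 cL).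
have rterm0 k j : L1_mean0 m (response_term (Lop 0) g k j) by exact: (response_term_mean0 cL g0).
have t1 : 0 < 1 - theta by rewrite subr_gt0; case/andP: theta01.
have small (e : R) : 0 < e -> \forall n \near \oo, C * theta ^+ n / (1 - theta) <= e.
  move=> e0; have := geometric_near0 (C / (1 - theta)) theta01 e0.
  by apply: filterS => n; rewrite mulrAC.
split=> //.
- apply: ereal_cvg0 => [N|e e0].
    have : (0 <= \sum_(N <= j <oo) L1norm m (term 0%Z j))%E.
      by apply: nneseries_ge0 => j _ _; exact: L1norm_ge0.
    by move=> /le_trans; apply; apply: ereal_sup_ubound; exists 0%Z.
  apply: filterS (small e e0) => N Ne; apply: ge_ereal_sup => _ [k _ <-].
  apply: (@le_trans _ _ (C * theta ^+ N / (1 - theta))%:E); last by rewrite lee_fin.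
  apply: nneseries_geometric_le => // j; rewrite L1norm_ge0/=.
  rewrite (L1norm_ae _ _ (termE k j)).
  + exact: (response_term_bound theta01 cL g0 gC).
  + by have [/Lfun1_measurable] := term0 k j.
  + by have [/Lfun1_measurable] := rterm0 k j.
- apply: ereal_cvg0 => [N|e e0]; first exact: linfL1norm_ge0.
  apply: filterS (small e e0) => N Ne; apply: linfL1norm_le => k.
  apply: (@le_trans _ _ (C * theta ^+ N / (1 - theta))%:E); last by rewrite lee_fin.
  apply: le_trans (response_partial_sum theta01 cL g0 gC k N).
  have etaL := (response_mean0 theta01 cL g0 gC k).1.
  apply: L1norm_le.
  + apply: measurable_funB; first exact: Lfun1_measurable etaL.
    by have [/Lfun1_measurable] := L1_mean0_sum N (term0 k).
  + apply: measurable_funB; first exact: Lfun1_measurable etaL.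
    by have [/Lfun1_measurable] := L1_mean0_sum N (rterm0 k).
  + apply: filterS (ae_foralln (termE k)) => y ty.
    by under eq_bigr do rewrite ty.
Qed.
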